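(* Let $k$ be an algebraically closed field of characteristic $p>0$, let $q=p^e$ with $e\ge1$, and let $X\subset\mathbb P^3_k$ be a smooth extremal surface of degree $d=q+1\ge 5$. Then $X$ contains at least $$\frac{1}{16}(q^3+1)(q^2+1)(q-1)^2q^7$$ collections of double $2d$'s.
   Context: $k$ is an algebraically closed field of characteristic $p>0$ and $q=p^e$ with $e\ge1$. A Frobenius form is a homogeneous polynomial of degree $q+1$ of the form $\sum_i x_i^{q}L_i$ with each $L_i$ a linear form. An extremal surface of degree $q+1$ is a surface in $\mathbb P^3_k$ defined by a Frobenius form of degree $q+1$ in four variables. A double $2d$ is a collection of two sets (unordered) $\mathcal A$ and $\mathcal B$, each consisting of $2d$ lines in $\mathbb P^3_k$, such that (1) each line in $\mathcal A$ (resp. $\mathcal B$) is skew to every other line in $\mathcal A$ (resp. $\mathcal B$); and (2) each line in $\mathcal A$ (resp. $\mathcal B$) intersects exactly $d+2$ lines in $\mathcal B$ (resp. $\mathcal A$). It is contained in $X$ if all its lines lie on $X$. *)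

(* Defs.v *)
From HB Require Import structures.
From mathcomp Require Import all_boot all_order all_algebra.
From mathcomp Require Import finmap.
From mathcomp Require Import mpoly.

Set Implicit Arguments.
Unset Strict Implicit.
Unset Printing Implicit Defensive.

Import Order.TTheory GRing.Theory Num.Theory.

Local Open Scope ring_scope.
Local Open Scope fset_scope.

(* Points of P^3 are represented by nonzero vectors of k^4, and a line of P^3
   by the corresponding 2-dimensional subspace of k^4.  The surface defined by
   a form F is handled through F itself. *)
Notation subspace4 k := {vspace 'rV[k]_4}.

Definition evalv (k : fieldType) (F : {mpoly k[4]}) (v : 'rV[k]_4) : k :=
  F.@[fun i => v 0 i].

Definition Frobenius_form (k : fieldType) (q : nat) (F : {mpoly k[4]}) : Prop :=
  exists L : 'I_4 -> {mpoly k[4]},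
    (forall i, L i \is 1.-homog) /\ F = \sum_(i < 4) 'X_i ^+ q * L i.

(* Jacobian criterion over an algebraically closed field: the form and its
   partial derivatives have no common projective zero.  In particular the zero
   form is excluded. *)
Definition smooth_surface (k : closedFieldType) (F : {mpoly k[4]}) : Prop :=
  forall v : 'rV[k]_4, v != 0 -> evalv F v = 0 ->
    exists i : 'I_4, evalv F^`M(i) v != 0.

Definition is_line (k : fieldType) (l : subspace4 k) : bool := \dim l == 2%N.

(* Two projective lines share a point iff the subspaces share a nonzero
   vector. *)
Definition meets (k : fieldType) (l m : subspace4 k) : bool :=
  (l :&: m)%VS != 0%VS.

Definition skew (k : fieldType) (l m : subspace4 k) : bool := ~~ meets l m.

(* As k is infinite in the intended use, vanishing at all points of l is the
   same as scheme-theoretic containment. *)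
Definition lies_on (k : fieldType) (l : subspace4 k) (F : {mpoly k[4]}) : Prop :=
  forall v : 'rV[k]_4, v \in l -> evalv F v = 0.

Definition set_of_lines (k : fieldType) (n : nat) (A : {fset subspace4 k}) :
    Prop :=
  #|` A| = n /\ forall l, l \in A -> is_line l.

Definition pairwise_skew (k : fieldType) (A : {fset subspace4 k}) : Prop :=
  forall l m, l \in A -> m \in A -> l != m -> skew l m.

Definition each_meets (k : fieldType) (n : nat) (A B : {fset subspace4 k}) :
    Prop :=
  forall l, l \in A -> #|` [fset m in B | meets l m]| = n.

(* The unordered pair of the sets of lines A and B is encoded as the finite set
   [fset A; B], so that exchanging A and B does not give a new double. *)
Definition double_2d (k : fieldType) (d : nat)
    (D : {fset {fset subspace4 k}}) : Prop :=
  exists A B : {fset subspace4 k},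
    [/\ D = [fset A; B],
        set_of_lines (2 * d) A /\ set_of_lines (2 * d) B,
        pairwise_skew A /\ pairwise_skew B
      & each_meets (d + 2) A B /\ each_meets (d + 2) B A].

Definition contained_in (k : fieldType) (D : {fset {fset subspace4 k}})
    (F : {mpoly k[4]}) : Prop :=
  forall A, A \in D -> forall l, l \in A -> lies_on l F.

(* Main.v *)
(* Write F(v) = h(v, v) with h(v, w) = v^[q] A w^T, where v^[q] is v with
   coordinates raised to the power q; smoothness says that A is invertible.  As
   k is algebraically closed, Lang's argument gives a basis (a "frame") in which
   A is the identity matrix; the frames are the translates of one of them by the
   finite unitary group U_4(q), whose order is computed by counting vectors of
   Hermitian norm 1.

   For a frame e0, e1, e2, e3 and lam^(q+1) = 1, the quadric y0 y3 = lam y1 y2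
   cuts the surface in the two families of q + 1 lines
     C_lam = { <e0 + a e2, e1 + lam a e3> }, D_lam = { <e0 + c e1, e2 + lam c e3> },
   a^(q+1) = c^(q+1) = -1.  A line of C_lam meets every line of D_lam, for mu <> lam
   it meets no line of D_mu, and it meets the line of C_mu with parameter b iff
   b = a or mu b = lam a.  So C_lam U D_mu and D_lam U C_mu form a double 2d.

   A double determines the frame up to 16 (q+1)^4 choices.  If a second triple
   (frame, lam', mu') gives the same lines, at least three of the q + 1 >= 5 lines
   of its C_lam' lie on one of the two quadrics of the first triple, and three
   skew lines determine a quadric; hence both triples give the same pair of
   quadrics.  The pencil they span contains the rank two forms y0 y3 and y1 y2,
   so the change of frame is a monomial matrix whose permutation preserves
   {{0, 3}, {1, 2}}, and it determines lam', mu' up to exchanging lam and mu. *)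
Require Import Defs.
From HB Require Import structures.
From mathcomp Require Import all_boot all_order perm all_algebra all_field.
From mathcomp Require Import finmap.
From mathcomp Require Import mpoly ring.

Set Implicit Arguments.
Unset Strict Implicit.
Unset Printing Implicit Defensive.

Import Order.TTheory GRing.Theory Num.Theory.

Local Open Scope ring_scope.

(** * The Frobenius morphism x |-> x^q *)

Definition frob (k : fieldType) (q : nat) of [pchar k].-nat q := fun x : k => x ^+ q.

Section FrobeniusMorphism.

Variables (k : fieldType) (q : nat) (hq : [pchar k].-nat q).

(** [frob] carries the proof [hq] as an argument so that the morphism structures can be attached to
    it and the [map_mx] theory applies. *)
Lemma frob_is_zmod_morphism : zmod_morphism (frob hq).
Proof.
by move=> x y; rewrite /frob exprDn_pchar // exprNn_pchar.
Qed.

Lemma frob_is_monoid_morphism : monoid_morphism (frob hq).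
Proof. by split=> [|x y]; rewrite /frob ?expr1n ?exprMn. Qed.

HB.instance Definition _ :=
  GRing.isZmodMorphism.Build k k (frob hq) frob_is_zmod_morphism.
HB.instance Definition _ :=
  GRing.isMonoidMorphism.Build k k (frob hq) frob_is_monoid_morphism.

Lemma nat_pchar0 : (1 < q)%N -> q%:R = 0 :> k.
Proof.
move=> q1; have [p p_pr pq] := pdivP q1.
have /(_ p) := pnatP _ (ltnW q1) hq; move=> /(_ p_pr pq) hp.
by apply/eqP; rewrite -(dvdn_pcharf hp).
Qed.

End FrobeniusMorphism.

(** * Root lists of separable polynomials *)

Section RootLists.

Variable k : closedFieldType.

Lemma closed_root (p : {poly k}) : (1 < size p)%N -> exists x, root p x.
Proof. by move=> p1; apply/closed_rootP; rewrite gtn_eqF. Qed.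

Lemma separable_roots (p : {poly k}) : separable_poly p ->
  exists s : seq k, [/\ uniq s, size s = (size p).-1 & forall x, (x \in s) = root p x].
Proof.
move=> sep_p; have [s Dp] := closed_field_poly_normal p.
have l0 : lead_coef p != 0 by rewrite lead_coef_eq0 separable_poly_neq0.
exists s; split.
- by rewrite -separable_prod_XsubC -(eqp_separable (eqp_scale _ l0)) -Dp.
- by rewrite Dp size_scale // size_prod_XsubC.
- by move=> x; rewrite Dp rootZ // root_prod_XsubC.
Qed.

(** Lists F_q and F_(q^2) inside k; the derivative is the constant -1, whence separability. *)
Lemma roots_XnsubX (m : nat) : (1 < m)%N -> m%:R = 0 :> k ->
  exists s : seq k, [/\ uniq s, size s = m & forall x, (x \in s) = (x ^+ m == x)].
Proof.
move=> m1 m0.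
have sz : size ('X^m - 'X : {poly k}) = m.+1.
  by rewrite size_polyDl size_polyXn // size_polyN size_polyX ltnS.
have [|s [us szs sE]] := @separable_roots ('X^m - 'X).
  rewrite unlock derivB derivXn derivX -mulr_natl -polyC_natr m0 mul0r sub0r.
  by rewrite -(scaleN1r 1) coprimepZr ?oppr_eq0 ?oner_eq0 // coprimep1.
exists s; split=> // [|x]; first by rewrite szs sz.
by rewrite sE /root !hornerE subr_eq0.
Qed.

(** With m = q + 1 this lists the elements of norm c. The derivative m X^(m-1) can vanish only at 0,
    which is not a root. *)
Lemma roots_Xnsubc (m : nat) (c : k) : m%:R != 0 :> k -> c != 0 ->
  exists s : seq k, [/\ uniq s, size s = m & forall x, (x \in s) = (x ^+ m == c)].
Proof.
move=> mn0 c0; have m0 : (0 < m)%N by case: m mn0; rewrite ?eqxx.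
have sz : size ('X^m - c%:P : {poly k}) = m.+1 by rewrite size_XnsubC.
have [|s [us szs sE]] := @separable_roots ('X^m - c%:P).
  rewrite unlock derivB derivXn derivC subr0 -scaler_nat coprimepZr //.
  apply: coprimep_expr; rewrite -[X in coprimep _ X]subr0 -polyC0 coprimep_XsubC.
  by rewrite rootE hornerD hornerN hornerXn hornerC expr0n eqn0Ngt m0 sub0r oppr_eq0.
exists s; split=> // [|x]; first by rewrite szs sz.
by rewrite sE /root !hornerE subr_eq0.
Qed.

End RootLists.

(** * Matrices with a prescribed first row *)

Section FirstRow.

Variable k : fieldType.

(** A nonzero row has rank one, so it is a scalar multiple of the first row of the invertible matrix
    [row_ebase v]. *)
Lemma unitmx_row0 n (v : 'rV[k]_n.+1) : v != 0 ->
  exists2 P : 'M[k]_n.+1, P \in unitmx & row 0 P = v.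
Proof.
move=> v0; have r1 : \rank v = 1%N by rewrite rank_rV v0.
have [E EE] : exists c, v = c *: row 0 (row_ebase v).
  exists (col_ebase v 0 0).
  rewrite -{1}(mulmx_ebase v) r1 [col_ebase v]mx11_scalar -mulmxA mul_scalar_mx mxE mulr1n.
  congr (_ *: _); apply/rowP=> j; rewrite !mxE (bigD1 0) //= big1 ?addr0.
    by rewrite mxE eqxx mul1r.
  by move=> i i0; rewrite mxE [0 == _]eq_sym -[_ == 0 :> nat]/(i == 0) (negPf i0) mul0r.
have E0 : E != 0 by apply: contraNneq v0 => E0; rewrite EE E0 scale0r.
exists (E *: row_ebase v).
  by rewrite unitmxZ ?unitfE // row_ebase_unit.
by rewrite linearZ /= -EE.
Qed.


Lemma row0_block n (A : 'M[k]_(1 + n)) : row 0 A = row 0 1%:M ->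
  A = block_mx 1%:M 0 (dlsubmx A) (drsubmx A).
Proof.
move=> A0; rewrite -[LHS]submxK.
have r0 : usubmx A = usubmx (1%:M : 'M[k]_(1 + n)).
  by apply/row_matrixP=> i; rewrite ord1 !row_usubmx (_ : lshift n 0 = 0) //; apply: val_inj.
by rewrite /ulsubmx /ursubmx r0 (scalar_mx_block 1 n 1) col_mxKu row_mxKl row_mxKr.
Qed.

Lemma row0_block_mx n (x : 'cV[k]_n) (B : 'M[k]_n) :
  row 0 (block_mx 1%:M 0 x B : 'M[k]_(1 + n)) = row 0 1%:M.
Proof.
apply/rowP=> j; rewrite (scalar_mx_block 1 n 1) !mxE.
by case: splitP => // i; rewrite ord1 => /eqP.
Qed.

End FirstRow.

(** * Lang's theorem for GL_n *)

Section Lang.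

Variables (k : closedFieldType) (q : nat) (hq : [pchar k].-nat q) (q1 : (1 < q)%N).
Local Notation "A ^f" := (map_mx (frob hq) A).

Lemma frob_mx_inj m n (A B : 'M[k]_(m, n)) : A^f = B^f -> A = B.
Proof. exact: map_mx_inj. Qed.

Lemma frob_mx_surj m n (A : 'M[k]_(m, n)) : exists B, B^f = A.
Proof.
have root_q c : exists x : k, x ^+ q == c.
  have sz : size ('X^q - c%:P : {poly k}) = q.+1 by rewrite size_XnsubC // ltnW.
  have [|x] := @closed_root k ('X^q - c%:P); first by rewrite sz ltnS ltnW.
  by rewrite /root !hornerE subr_eq0; exists x.
exists (\matrix_(i, j) xchoose (root_q (A i j))).
by apply/matrixP=> i j; rewrite !mxE; apply/eqP/(xchooseP (root_q (A i j))).
Qed.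

(* In the orbit v0, v1, ... of a nonzero row under v |-> v^[q] C, let v_m be the
   first one that is a combination of the previous ones.  Looking for a fixed row
   sum_(i < m) x_i v_i, all x_i are polynomials in t = x_(m-1), and t is a nonzero
   root of a polynomial in one variable. *)
Lemma fixed_row n (C : 'M[k]_n.+1) : C \in unitmx ->
  exists2 v : 'rV[k]_n.+1, v != 0 & v^f *m C = v.
Proof.
move=> uC; pose phi (v : 'rV[k]_n.+1) := v^f *m C.
have phi0 v : v != 0 -> phi v != 0.
  apply: contra_neq => /(canRL (mulmxK uC)); rewrite mul0mx => v0.
  by apply: frob_mx_inj; rewrite v0 map_mx0.
pose v i := iter i phi (delta_mx 0 0).
have v0 i : v i != 0.
  elim: i => [|i /phi0 //]; apply/eqP=> /matrixP/(_ 0 0)/eqP.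
  by rewrite !mxE oner_eq0.
have vS i : v i.+1 = (v i)^f *m C by [].
clearbody v; pose M m := \matrix_(i < m) v i.
have exP : exists m, (v m <= M m)%MS.
  case: (boolP [exists m : 'I_n.+2, (v m <= M m)%MS]) => [/existsP[m]|]; first by exists m.
  rewrite negb_exists => /forallP nP; suff: (n.+2 <= \rank (M n.+2))%N.
    by rewrite leqNgt ltnS rank_leq_col.
  suff: forall m, (m <= n.+2)%N -> (m <= \rank (M m))%N by apply.
  elim=> // m IHm lt_m; apply: leq_ltn_trans (IHm (ltnW lt_m)) _.
  apply: rank_ltmx; apply/andP; split.
    apply/row_subP=> i; rewrite rowK.
    by rewrite (_ : v i = row (widen_ord (leqnSn m) i) (M m.+1)) ?row_sub // rowK.
  apply: contra (nP (Ordinal lt_m)) => /= sM; apply: submx_trans sM.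
  by rewrite (_ : v m = row ord_max (M m.+1)) ?row_sub // rowK.
case: (ex_minnP exP) => [[|m]] /submxP[D DE] minm.
  by have := v0 0%N; rewrite DE (flatmx0 (M 0)) mulmx0 eqxx.
pose a i := D 0 (inord i).
have vmE : v m.+1 = \sum_(i < m.+1) a i *: v i.
  rewrite DE mulmx_sum_row; apply: eq_bigr => i _.
  by rewrite rowK /a inord_val.
have [j aj] : exists j : 'I_m.+1, a j != 0.
  apply/existsP; apply: contraNT (v0 m.+1); rewrite negb_exists => /forallP a0.
  by rewrite vmE big1 // => i _; move: (a0 i); rewrite negbK => /eqP->; rewrite scale0r.
(* With x_i = t^q R_i(t), the recurrence x_(i+1) = x_i^q + a_(i+1) t^q imposed by the fixed row
   turns into this recursion. *)
pose fix R i : {poly k} := if i is i'.+1 then 'X^(q * q.-1) * R i' ^+ q + (a i)%:P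
  else (a 0)%:P.
have RS i : R i.+1 = 'X^(q * q.-1) * R i ^+ q + (a i.+1)%:P by [].
(* The first summand has degree at least q(q - 1) > 0, so a constant cannot cancel it. *)
have RS0 i : R i != 0 -> R i.+1 != 0.
  move=> Ri; have sz : (1 < size ('X^(q * q.-1) * R i ^+ q)%R)%N.
    rewrite mulrC size_mulXn ?expf_neq0 // ltn_addr //.
    by rewrite (leq_trans q1) // leq_pmulr // -ltnS prednK // ltnW.
  rewrite RS -size_poly_gt0 size_polyDl ?(ltnW sz) //.
  by rewrite (leq_ltn_trans _ sz) // size_polyC leq_b1.
have {aj} Rm : R m != 0.
  suff H i : (j <= i)%N -> R i != 0 by apply: H; rewrite -ltnS.
  elim: i => [|i IHi]; first by rewrite leqn0 => /eqP j0; move: aj; rewrite polyC_eq0 j0.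
  rewrite leq_eqVlt => /orP[/eqP ji|]; last by rewrite ltnS => /IHi /RS0.
  have [R0|/RS0 //] := eqVneq (R i) 0.
  by rewrite RS R0 expr0n eqn0Ngt (ltnW q1) mulr0 add0r polyC_eq0; move: aj; rewrite ji.
(* The closing condition x_m = t reads t^q R_m(t) = t; the factor t is divided out to keep the root
   nonzero. *)
have [|t] := @closed_root k ('X^(q.-1) * R m - 1).
  have sz : (1 < size ('X^(q.-1) * R m)%R)%N.
    rewrite mulrC size_mulXn // -addn1 leq_add ?size_poly_gt0 //.
    by rewrite -ltnS prednK // ltnW.
  by rewrite size_polyDl // size_polyN size_poly1.
rewrite rootE !hornerE subr_eq0 => /eqP tR.
have t0 : t != 0.
  apply/eqP=> t0; move: tR; rewrite t0 expr0n -subn1 subn_eq0 leqNgt q1 mul0r.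
  by move/eqP; rewrite eq_sym oner_eq0.
pose x i := t ^+ q * (R i).[t].
have xS i : x i.+1 = x i ^+ q + a i.+1 * t ^+ q.
  rewrite /x RS !hornerE mulrDr [t ^+ q * a _]mulrC exprMn -exprM mulrA -exprD.
  by rewrite -mulnS prednK // ltnW.
have xm : x m = t by rewrite /x -(prednK (ltnW q1)) exprS -mulrA tR mulr1.
exists (\sum_(i < m.+1) x i *: v i).
  (* If the sum vanished, its last coefficient t being nonzero, v_m would be a combination of the
     earlier rows, against minimality. *)
  apply/eqP; rewrite big_ord_recr /= xm => /eqP; rewrite addrC addr_eq0 => /eqP vmE'.
  have: (v m <= M m)%MS.
    rewrite -[v m](scalerK t0) vmE' -scaleN1r !scalemx_sub //.
    apply: summx_sub => i _; apply: scalemx_sub.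
    by rewrite (_ : v i = row i (M m)) ?row_sub // rowK.
  by move/minm; rewrite ltnn.
have -> : (\sum_(i < m.+1) x i *: v i)^f *m C = \sum_(i < m.+1) x i ^+ q *: v i.+1.
  rewrite raddf_sum mulmx_suml; apply: eq_bigr => i _ /=.
  by rewrite map_mxZ -scalemxAl vS.
rewrite big_ord_recr /= xm vmE scaler_sumr 2!(big_ord_recl m) /= addrCA -big_split /=.
congr (_ + _); first by rewrite scalerA /x /= hornerC.
by apply: eq_bigr => i _; rewrite xS scalerDl scalerA [t ^+ q * _]mulrC.
Qed.

(** By induction: a fixed row taken as first basis vector makes C block lower triangular with corner
    1. The lower right block is trivialized by induction, and the column below the corner by solving
    Artin-Schreier equations x^q + c = x. *)
Lemma frobenius_trivialization n (C : 'M[k]_n) : C \in unitmx ->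
  exists2 g : 'M[k]_n, g \in unitmx & g^f *m C = g.
Proof.
elim: n C => [|n IHn] C uC; first by exists 1%:M; rewrite ?unitmx1 // [LHS]flatmx0 [RHS]flatmx0.
have [v v0 vC] := fixed_row uC.
have [P uP rP] := unitmx_row0 v0.
pose C' : 'M_(1 + n) := P^f *m C *m invmx P.
have uC' : C' \in unitmx by rewrite !unitmx_mul uC unitmx_inv uP map_unitmx uP.
have /row0_block C'E : row 0 C' = row 0 1%:M.
  by rewrite !row_mul -map_row rP vC -rP -row_mul mulmxV.
have [|g ug gC] := IHn (drsubmx C').
  by move: uC'; rewrite {1}C'E !unitmxE det_lblock det1 mul1r.
have AS (c : k) : exists x, x ^+ q + c == x.
  have sz : (1 < size ('X^q - 'X + c%:P : {poly k})%R)%N.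
    have sq : size ('X^q - 'X : {poly k}) = q.+1.
      by rewrite size_polyDl size_polyXn // size_polyN size_polyX ltnS.
    by rewrite size_polyDl sq ?ltnS ?(ltnW q1) // size_polyC (leq_trans (leq_b1 _)) // ltnW.
  have [x] := closed_root sz.
  rewrite rootE !hornerE => /eqP x0; exists x; rewrite -subr_eq0 -x0.
  by rewrite addrAC.
pose x : 'cV[k]_n := \col_i xchoose (AS ((g^f *m dlsubmx C') i 0)).
have xE : x^f + g^f *m dlsubmx C' = x.
  apply/colP=> i; rewrite !mxE; apply/eqP.
  by have := xchooseP (AS ((g^f *m dlsubmx C') i 0)); rewrite mxE.
pose B : 'M_(1 + n) := block_mx 1%:M 0 x g.
have uB : B \in unitmx by rewrite unitmxE det_lblock det1 mul1r -unitmxE.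
have BC : B^f *m C' = B.
  rewrite {1}C'E map_block_mx mulmx_block map_mx1 map_mx0.
  by rewrite !mulmx1 !mul0mx !mulmx0 !addr0 add0r xE gC.
exists (B *m P); first by rewrite unitmx_mul uB.
rewrite map_mxM -mulmxA -[in RHS]BC -mulmxA; congr (_ *m _).
by rewrite mulmxKV.
Qed.

End Lang.

(** * Unitary bases for the form h *)

Section HermitianForms.

Variables (k : closedFieldType) (q : nat) (hq : [pchar k].-nat q) (q1 : (1 < q)%N).
Local Notation "A ^f" := (map_mx (frob hq) A).

Lemma pchar_nat_sq : [pchar k].-nat (q * q)%N.
Proof. by rewrite pnatM hq. Qed.

Lemma frob_sq x : frob pchar_nat_sq x = frob hq (frob hq x).
Proof. by rewrite /frob -exprM. Qed.

Lemma map_frob_sq m n (A : 'M[k]_(m, n)) : map_mx (frob pchar_nat_sq) A = A^f^f.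
Proof. by apply/matrixP=> i j; rewrite !mxE frob_sq. Qed.

Lemma q_sq_gt1 : (1 < q * q)%N.
Proof. by rewrite (leq_trans q1) // leq_pmulr // ltnW. Qed.

Lemma frob_sq_norm (c x : k) : c ^+ q = c -> c != 0 -> x ^+ q.+1 = c ->
  frob hq (frob hq x) = x.
Proof.
rewrite /frob => cq c0 xc; have x0 : x != 0.
  by apply: contraNneq c0 => x0; rewrite -xc x0 expr0n.
have xq : x ^+ q = c / x by rewrite -xc exprSr mulfK.
by rewrite xq expr_div_n cq xq invf_div mulrC divfK.
Qed.

Lemma q1_neq0 : q.+1%:R != 0 :> k.
Proof. by rewrite -natr1 nat_pchar0 // add0r oner_eq0. Qed.

(** Equivalently h(v, w)^q = h(w, v) for all w. For invertible A these vectors form an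
    F_(q^2)-structure on k^n, on which h is Hermitian. *)
Definition hermitian_vector n (A : 'M[k]_n) (v : 'rV[k]_n) :=
  v^f^f *m A^f = v *m A^T.

Lemma hermitian_vectorD n (A : 'M[k]_n) u v :
  hermitian_vector A u -> hermitian_vector A v -> hermitian_vector A (u + v).
Proof. by rewrite /hermitian_vector => Au Av; rewrite !map_mxD !mulmxDl Au Av. Qed.

Lemma hermitian_vectorZ n (A : 'M[k]_n) c v : frob hq (frob hq c) = c ->
  hermitian_vector A v -> hermitian_vector A (c *: v).
Proof.
by rewrite /hermitian_vector => cE Av; rewrite !map_mxZ -!scalemxAl Av /= cE.
Qed.

(** The norm N of a Hermitian vector satisfies N^q = N, so a solution t of t^(q+1) = 1/N lies in
    F_(q^2), and scaling by it keeps the vector Hermitian. *)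
Lemma hermitian_normalize n (A : 'M[k]_n) v : hermitian_vector A v ->
  v^f *m A *m v^T != 0 ->
  exists2 t, hermitian_vector A (t *: v) & (t *: v)^f *m A *m (t *: v)^T = 1%:M.
Proof.
move=> Av; set N := v^f *m A *m v^T => N0.
have NE : N = (N 0 0)%:M by rewrite [LHS]mx11_scalar.
have c0 : N 0 0 != 0 by apply: contraNneq N0 => c0; rewrite NE c0 raddf0.
have Nq : N^f = N^T.
  by rewrite !map_mxM Av !trmx_mul trmxK map_trmx mulmxA.
have cq : (N 0 0) ^+ q = N 0 0 by have /matrixP/(_ 0 0) := Nq; rewrite !mxE.
have [|s [_ szs sE]] := roots_Xnsubc q1_neq0 (c := (N 0 0)^-1); first by rewrite invr_eq0.
have : nth 0 s 0 \in s by rewrite mem_nth // szs.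
set t := nth 0 s 0; rewrite sE => /eqP tE; exists t.
  apply: hermitian_vectorZ => //; apply: frob_sq_norm tE; last by rewrite invr_eq0.
  by rewrite exprVn cq.
rewrite map_mxZ linearZ /= -!scalemxAl -scalemxAr scalerA -/N NE scale_scalar_mx.
by rewrite /frob -exprSr tE mulVf.
Qed.

(** The polynomial X^q + X has at most q roots, fewer than the q^2 elements of F_(q^2). *)
Lemma exists_trace_neq0 : exists2 t : k, frob hq (frob hq t) = t & t + frob hq t != 0.
Proof.
have Q0 : (q * q)%:R = 0 :> k by rewrite natrM nat_pchar0 // mul0r.
have [s [us szs sE]] := roots_XnsubX q_sq_gt1 Q0.
have sz : size ('X^q + 'X : {poly k}) = q.+1.
  by rewrite size_polyDl size_polyXn // size_polyX ltnS.
have p0 : ('X^q + 'X : {poly k}) != 0 by rewrite -size_poly_eq0 sz.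
have : ~~ all (root ('X^q + 'X)) s.
  apply/negP=> /(max_poly_roots p0)/(_ us); rewrite szs sz ltnS.
  by rewrite leqNgt -{1}(muln1 q) ltn_pmul2l ?q1 // ltnW.
case/allPn=> t; rewrite sE /root !hornerE addrC => /eqP tE tN; exists t => //.
by rewrite /frob -exprM.
Qed.

(** Lang's theorem for the q^2-Frobenius gives a basis g of Hermitian vectors. Its Gram matrix H is
    Hermitian and invertible, so either a diagonal entry is nonzero or two basis vectors combine to
    a vector of nonzero norm. *)
Lemma hermitian_unit_vector n (A : 'M[k]_n.+1) : A \in unitmx ->
  exists2 v, hermitian_vector A v & v^f *m A *m v^T = 1%:M.
Proof.
move=> uA; have uAT : A^T \in unitmx by rewrite unitmx_tr.
have [|g ug gC] := frobenius_trivialization pchar_nat_sq q_sq_gt1 (C := A^f *m invmx A^T).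
  by rewrite unitmx_mul map_unitmx uA unitmx_inv.
have gA : g^f^f *m A^f = g *m A^T.
  by rewrite -[in RHS]gC map_frob_sq -!mulmxA mulVmx // mulmx1.
have Ag i : hermitian_vector A (row i g).
  by rewrite /hermitian_vector !map_row -!row_mul gA.
pose H := g^f *m A *m g^T.
have uH : H \in unitmx by rewrite !unitmx_mul map_unitmx ug uA unitmx_tr ug.
have Hq i j : frob hq (H i j) = H j i.
  have /matrixP/(_ i j) : H^f = H^T by rewrite !map_mxM gA !trmx_mul trmxK map_trmx mulmxA.
  by rewrite !mxE.
have HE i j : (row i g)^f *m A *m (row j g)^T = (H i j)%:M.
  rewrite [LHS]mx11_scalar; congr (_%:M).
  by rewrite map_row -row_mul tr_row !mxE; apply: eq_bigr => l _; rewrite !mxE.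
suff [v Av v0] : exists2 v, hermitian_vector A v & v^f *m A *m v^T != 0.
  by have [t] := hermitian_normalize Av v0; exists (t *: v).
have [i Hi|Hi0] := pickP (fun i => H i i != 0).
  by exists (row i g); rewrite // HE -scalemx1 scaler_eq0 negb_or Hi oner_eq0.
have [[i j] /= Hij|H0] := pickP (fun ij => H ij.1 ij.2 != 0); last first.
  have H00 : H = 0.
    by apply/matrixP=> i j; rewrite [RHS]mxE; apply/eqP; have /negbFE := H0 (i, j).
  by move: uH; rewrite H00 unitmxE det0 unitr0.
(* When the diagonal of H is zero, g_i + c g_j has norm c H_ij + (c H_ij)^q; this c makes it the
   trace of t. *)
have [t tE tN] := exists_trace_neq0; pose c := t / H i j.
exists (row i g + c *: row j g).
  apply: hermitian_vectorD => //; apply: hermitian_vectorZ => //.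
  by rewrite /c !rmorphM !fmorphV /= tE !Hq.
have cH : c * H i j = t by rewrite divfK.
rewrite map_mxD linearD /= !mulmxDl !mulmxDr map_mxZ linearZ /= -!scalemxAl -!scalemxAr !HE.
have /negbFE/eqP -> := Hi0 i; have /negbFE/eqP -> := Hi0 j.
rewrite !scale_scalar_mx !mulr0 (raddf0 (@scalar_mx k 1)) add0r addr0 cH -(Hq i j) -rmorphM cH.
by rewrite -raddfD; apply: contraNneq tN => /matrixP/(_ 0 0)/eqP; rewrite !mxE mulr1n.
Qed.

(** One Gram-Schmidt step. As v is Hermitian, the off-diagonal blocks of the Gram matrix are
    conjugate transposes, so the single matrix B clears both. *)
Lemma orthogonal_splitting n (A : 'M[k]_(1 + n)) (v : 'rV[k]_(1 + n)) :
  A \in unitmx -> hermitian_vector A v -> v^f *m A *m v^T = 1%:M ->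
  exists P : 'M[k]_(1 + n), exists A' : 'M[k]_n,
    [/\ row 0 P = v, A' \in unitmx & P^f *m A *m P^T = block_mx 1%:M 0 0 A'].
Proof.
move=> uA Av v1.
have v0 : v != 0.
  apply: contra_eqN v1 => /eqP->; rewrite map_mx0 !mul0mx.
  by rewrite eq_sym -scalemx1 scaler_eq0 negb_or !oner_eq0.
have [P uP rP] := unitmx_row0 v0; rewrite -[n.+1]/(1 + n)%N in P uP rP.
pose G : 'M[k]_(1 + n) := P^f *m A *m P^T.
have uPE : usubmx P = v.
  apply/row_matrixP=> i; rewrite ord1 row_usubmx -(row_id 0 v) -[in RHS]rP.
  by rewrite (_ : lshift n 0 = 0) ?row_id //; apply: val_inj.
have PE : P = col_mx v (dsubmx P) by rewrite -uPE vsubmxK.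
have GE : G = block_mx 1%:M (v^f *m A *m (dsubmx P)^T) ((dsubmx P)^f *m A *m v^T)
                 ((dsubmx P)^f *m A *m (dsubmx P)^T).
  by rewrite /G {1 2}PE map_col_mx tr_col_mx mul_col_mx mul_col_row v1.
have uG : G \in unitmx by rewrite !unitmx_mul map_unitmx unitmx_tr uP uA.
set b := v^f *m A *m _ in GE; set b' := _ *m v^T in GE; set D := (_ *m _) in GE.
have bE : (b^T)^f = b'.
  rewrite /b -map_trmx !map_mxM Av.
  by rewrite !trmx_mul trmxK map_trmx !trmxK mulmxA.
pose B : 'M[k]_(1 + n) := block_mx 1%:M 0 (- b^T) 1%:M.
have BG : B^f *m G *m B^T = block_mx 1%:M 0 0 (D - b' *m b).
  rewrite GE /B map_block_mx tr_block_mx !map_mx1 map_mx0 !trmx1 trmx0 linearN /= trmxK.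
  rewrite map_mxN bE !mulmx_block !mul1mx !mul0mx !mulmx1 !mulmx0 !addr0.
  by rewrite mul1mx !addNr mul0mx add0r mulNmx [_ + D]addrC.
have uB : B \in unitmx by rewrite unitmxE det_lblock !det1 mulr1 unitr1.
exists (B *m P); exists (D - b' *m b); split.
- by rewrite row_mul row0_block_mx -row_mul mul1mx.
- have : B^f *m G *m B^T \in unitmx by rewrite unitmx_mul [_ *m _ \in _]unitmx_mul map_unitmx
  unitmx_tr uB uG.
  by rewrite BG unitmxE det_lblock det1 mul1r -unitmxE.
- by rewrite -BG /G map_mxM trmx_mul !mulmxA.
Qed.

(** The lower-dimensional statement is a premise, so that the lemma serves the induction in
    [unitary_basis] as well as the completion of a given unit row when unitary matrices are
    counted. *)
Lemma unitary_basis_row0 n (A : 'M[k]_(1 + n)) (v : 'rV[k]_(1 + n)) :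
  (forall A' : 'M[k]_n, A' \in unitmx -> exists g : 'M[k]_n, g^f *m A' *m g^T = 1%:M) ->
  A \in unitmx -> hermitian_vector A v -> v^f *m A *m v^T = 1%:M ->
  exists2 g : 'M[k]_(1 + n), g^f *m A *m g^T = 1%:M & row 0 g = v.
Proof.
move=> IH uA Av v1; have [P [A' [rP uA' PE]]] := orthogonal_splitting uA Av v1.
have [g gE] := IH A' uA'; pose B : 'M[k]_(1 + n) := block_mx 1%:M 0 0 g.
exists (B *m P).
  rewrite map_mxM trmx_mul -!mulmxA (mulmxA A) (mulmxA P^f) (mulmxA P^f) PE.
  rewrite mulmxA /B map_block_mx tr_block_mx !mulmx_block map_mx1 !map_mx0 trmx1 !trmx0.
  by rewrite !mul1mx !mulmx0 !mulmx1 !addr0 !add0r !mul0mx gE (scalar_mx_block 1 n 1).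
by rewrite row_mul row0_block_mx -row_mul mul1mx.
Qed.

Lemma unitary_basis n (A : 'M[k]_n) : A \in unitmx -> exists g : 'M[k]_n, g^f *m A *m g^T = 1%:M.
Proof.
elim: n A => [|n IHn] A uA; first by exists 1%:M; rewrite [LHS]flatmx0 [RHS]flatmx0.
have [v Av v1] := hermitian_unit_vector uA.
by have [g gE _] := unitary_basis_row0 (n := n) IHn uA Av v1; exists g.
Qed.

End HermitianForms.

(** * Counting vectors of given norm and unitary matrices *)

Lemma uniq_allpairs_dep (S T U : eqType) (f : S -> T -> U) (s : seq S) (t : S -> seq T) :
  uniq s -> {in s, forall x, uniq (t x)} ->
  (forall x x' y y', x \in s -> x' \in s -> y \in t x -> y' \in t x' ->
     f x y = f x' y' -> x = x' /\ y = y') ->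
  uniq [seq f x y | x <- s, y <- t x].
Proof.
move=> us ut f_inj; apply: allpairs_uniq_dep => // u v.
case/allpairsPdep=> x [y [xs yt ->]]; case/allpairsPdep=> x' [y' [xs' yt' ->]] /= E.
by have [-> ->] := f_inj _ _ _ _ xs xs' yt yt' E.
Qed.

(* The numbers of vectors of Hermitian norm 0, and of any given nonzero norm in
   F_q, in an n-dimensional Hermitian space over F_(q^2). *)
Fixpoint sphere_card (q n : nat) : nat * nat :=
  if n is m.+1 then
    let: (a, b) := sphere_card q m in
    (a + q.-1 * (q.+1 * b), q.+1 * a + (b + q.-2 * (q.+1 * b)))%N
  else (1, 0)%N.

Section Counting.

Variables (k : closedFieldType) (q : nat) (hq : [pchar k].-nat q) (q1 : (1 < q)%N).
Local Notation "A ^f" := (map_mx (frob hq) A).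

(** The first condition says that the coordinates lie in F_(q^2). *)
Definition sphere n (c : k) (v : 'rV[k]_n) :=
  (v^f^f == v) && (v^f *m v^T == c%:M).

Lemma sphere_row_mx n (x c d : k) (v : 'rV[k]_n) :
  frob hq (frob hq x) = x -> x ^+ q.+1 = c - d -> sphere d v ->
  sphere (n := 1 + n) c (row_mx x%:M v).
Proof.
move=> xx xc /andP[/eqP vv /eqP vd]; rewrite /sphere !map_row_mx vv !map_scalar_mx /= xx eqxx.
rewrite tr_row_mx mul_row_col vd tr_scalar_mx -scalar_mxM /frob -exprSr xc.
by rewrite -raddfD subrK eqxx.
Qed.

(* The hypothesis is a boolean premise under the quantifier so that [xchoose]
   yields a total function of [e]; likewise in [sphere_seq]. *)
Lemma norm_fibre (e : k) : exists s : seq k, (e ^+ q == e) ==>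
  [&& uniq s, size s == (if e == 0%R then 1 else q.+1)%N &
    all (fun x => (frob hq (frob hq x) == x) && (x ^+ q.+1 == e)) s].
Proof.
have [eq|_] := eqVneq (e ^+ q) e; last by exists [::].
have [->|e0] := eqVneq e 0.
  by exists [:: 0]; rewrite /= !rmorph0 expr0n !eqxx.
have [s [us szs sE]] := roots_Xnsubc (q1_neq0 hq q1) e0.
exists s; rewrite us szs eqxx /=; apply/allP=> x; rewrite sE => /eqP xe.
by rewrite xe eqxx andbT; apply/eqP/(frob_sq_norm hq eq).
Qed.

(** A row of norm c consists of an entry x and a tail of norm d with x^(q+1) = c - d, where d runs
    over F_q. *)
Lemma sphere_seq n (c : k) : exists s : seq 'rV[k]_n, (c ^+ q == c) ==>
  [&& uniq s, all (sphere c) s &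
    size s == (if c == 0%R then (sphere_card q n).1 else (sphere_card q n).2)].
Proof.
elim: n c => [|n IHn] c.
  have [c0|c0] := eqVneq c 0; last by exists [::]; rewrite implybT.
  exists [:: 0]; rewrite /= /sphere c0 andbT.
  by rewrite !map_mx0 mul0mx (raddf0 (@scalar_mx k 1)) !eqxx implybT.
have [cq|_] := eqVneq (c ^+ q) c; last by exists [::].
have [S [uS szS SE]] := roots_XnsubX q1 (nat_pchar0 hq q1).
have subq d : d \in S -> (c - d) ^+ q == c - d.
  by rewrite SE => /eqP dq; rewrite -/(frob hq (c - d)) rmorphB /= /frob cq dq.
pose R e := xchoose (norm_fibre e); pose Z d := xchoose (IHn d).
have RP d : d \in S -> _ := fun dS => implyP (xchooseP (norm_fibre (c - d))) (subq d dS).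
have ZP d : d \in S -> _ := fun dS => implyP (xchooseP (IHn d)) (etrans (esym (SE d)) dS).
pose T d : seq 'rV[k]_(1 + n) := [seq row_mx x%:M v | x <- R (c - d), v <- Z d].
exists [seq v | d <- S, v <- T d]; rewrite /=.
(* The norm d of the tail can be read off the row, so distinct d contribute disjoint lists. *)
have TE d w : d \in S -> w \in T d ->
    sphere c w /\ (rsubmx w)^f *m (rsubmx w)^T = d%:M.
  move=> dS /allpairsP[[x v] /= [xR vZ ->]].
  have /and3P[_ _ /allP/(_ x xR)/andP[/eqP xx /eqP xc]] := RP d dS.
  have /and3P[_ /allP/(_ v vZ) vd _] := ZP d dS.
  by rewrite row_mxKr (sphere_row_mx xx xc vd); case/andP: vd => _ /eqP ->.
apply/and3P; split.
- apply: uniq_allpairs_dep => // [d dS|d d' w w' dS dS' wT wT' ww'].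
    have /and3P[uR _ _] := RP d dS; have /and3P[uZ _ _] := ZP d dS.
    apply: allpairs_uniq => // -[x v] [x' v'] _ _ /= /eq_row_mx[/matrixP/(_ 0 0) xx ->].
    by move: xx; rewrite !mxE !mulr1n => ->.
  split=> //; have [_ wE] := TE d w dS wT; have [_] := TE d' w' dS' wT'.
  by rewrite -ww' wE => /matrixP/(_ 0 0); rewrite !mxE !mulr1n.
- by apply/allP=> w /allpairsPdep[d [w' [dS wT ->]]]; case: (TE _ _ dS wT).
rewrite size_allpairs_dep sumnE big_map.
have -> : (\sum_(d <- S) size (T d) = \sum_(d <- S) (if (c - d == 0)%R then 1 else q.+1) *
    (if (d == 0)%R then (sphere_card q n).1 else (sphere_card q n).2))%N.
  apply: eq_big_seq => d dS; rewrite size_allpairs.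
  have /and3P[_ /eqP-> _] := RP d dS.
  by have /and3P[_ _ /eqP->] := ZP d dS.
(* The terms d = 0 (isotropic tails) and d = c (only x = 0 is possible) are split off; all other
   terms are equal. *)
have S0 : 0 \in S by rewrite SE expr0n eqn0Ngt (ltnW q1).
have cS : c \in S by rewrite SE cq.
rewrite (big_rem _ S0) /= subr0 eqxx.
have rE := mem_rem_uniq 0 uS.
have sum_const (I : eqType) (r : seq I) (F : I -> nat) m :
  {in r, forall i, F i = m} -> (\sum_(i <- r) F i = size r * m)%N.
  by move=> Fm; rewrite (eq_big_seq _ Fm) big_const_seq count_predT iter_addn_0 mulnC.
case: (sphere_card q n) => a b /=; have [c0|c0] := eqVneq c 0.
  rewrite mul1n (@sum_const _ _ _ (q.+1 * b)%N) ?size_rem ?szS //.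
  by move=> d; rewrite rE !inE c0 sub0r oppr_eq0 => /andP[/negPf->].
have cS' : c \in rem 0 S by rewrite rE !inE c0.
rewrite (big_rem _ cS') /= subrr eqxx (negPf c0) mul1n.
rewrite (@sum_const _ _ _ (q.+1 * b)%N) ?size_rem ?szS //.
move=> d; rewrite mem_rem_uniq ?rem_uniq // !inE rE !inE => /and3P[dc /negPf-> _].
by rewrite subr_eq0 eq_sym (negPf dc).
Qed.

(** This equation alone forces entries in F_(q^2): applying Frobenius and transposing show that
    u^f^f and u are both inverse to the transpose of u^f. *)
Definition unitary n (u : 'M[k]_n) := u^f *m u^T == 1%:M.

Lemma unitary_unitmx n (u : 'M[k]_n) : unitary u -> u \in unitmx.
Proof. by move=> /eqP/mulmx1_unit[_]; rewrite unitmx_tr. Qed.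

Lemma unitary_row_completion n (v : 'rV[k]_(1 + n)) :
  exists g : 'M[k]_(1 + n), sphere 1 v ==> unitary g && (row 0 g == v).
Proof.
have [/andP[/eqP vv /eqP v1]|_] := boolP (sphere 1 v); last by exists 0.
have [|||g] := unitary_basis_row0 (n := n) (A := 1%:M) (v := v) (unitary_basis hq q1 (n := n)).
- exact: unitmx1.
- by rewrite /hermitian_vector map_mx1 trmx1 vv.
- by rewrite mulmx1.
by rewrite mulmx1 => gE rg; exists g; rewrite /unitary gE rg !eqxx.
Qed.

(** A unit row v, completed to a unitary matrix G v, is combined with a smaller unitary block.
    Distinctness suffices, since only a lower bound is wanted. *)
Lemma unitary_seq n : exists s : seq 'M[k]_n,
  [/\ uniq s, all (@unitary n) s & size s = (\prod_(1 <= i < n.+1) (sphere_card q i).2)%N].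
Proof.
elim: n => [|n [s [us sU szs]]].
  exists [:: 1%:M]; split; rewrite ?big_geq //= andbT /unitary.
  by rewrite map_mx1 trmx1 mulmx1.
have [Z /implyP/(_ _)/and3P[|uZ ZP /eqP szZ]] := sphere_seq n.+1 1; first by rewrite expr1n.
pose G v := xchoose (@unitary_row_completion n v).
have GP v : v \in Z -> unitary (G v) && (row 0 (G v) == v).
  by move=> /(allP ZP) v1; apply: (implyP (xchooseP (unitary_row_completion v))).
pose B u : 'M[k]_(1 + n) := block_mx 1%:M 0 0 u.
have rB u v : v \in Z -> row 0 (B u *m G v) = v.
  move=> vZ; have /andP[_ /eqP rG] := GP v vZ.
  by rewrite row_mul row0_block_mx -row_mul mul1mx.
exists [seq B u *m G v | v <- Z, u <- s]; split.
- apply: uniq_allpairs_dep => // v v' u u' vZ vZ' us' us'' E.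
  have vv : v = v' by rewrite -(rB u v) // E rB.
  have /andP[/unitary_unitmx uG _] := GP v vZ.
  move: E; rewrite -vv => /(can_inj (mulmxK uG)) BB.
  by have /eq_block_mx[_ _ _ ->] : block_mx 1%:M 0 0 u = block_mx 1%:M 0 0 u' :> 'M_(1 + n) := BB.
- apply/allP=> g /allpairsP[[v u] /= [vZ us' ->]].
  have /andP[/eqP GU _] := GP v vZ; have /eqP uU := allP sU u us'.
  rewrite /unitary -[n.+1]/(1 + n)%N map_mxM trmx_mul mulmxA -(mulmxA (B u)^f) GU mulmx1.
  rewrite /B map_block_mx tr_block_mx mulmx_block map_mx1 !map_mx0 trmx1 !trmx0.
  by rewrite !mul1mx !mulmx0 !mulmx1 !addr0 !add0r !mul0mx uU (scalar_mx_block 1 n 1).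
- by rewrite size_allpairs szZ szs oner_eq0 [RHS]big_nat_recr // [LHS]mulnC.
Qed.

End Counting.

(** * Lines of the two rulings attached to a frame *)

Section Rulings.

Variable k : fieldType.
Implicit Types (g : 'M[k]_4) (a b c lam mu s t : k) (v : 'rV[k]_4).

Definition vec4 (x0 x1 x2 x3 : k) : 'rV[k]_4 := \row_i nth 0 [:: x0; x1; x2; x3] i.

Lemma vec4_inj x0 x1 x2 x3 y0 y1 y2 y3 : vec4 x0 x1 x2 x3 = vec4 y0 y1 y2 y3 ->
  [/\ x0 = y0, x1 = y1, x2 = y2 & x3 = y3].
Proof.
by move/rowP=> E; split; [have := E 0 | have := E 1 | have := E 2%:R | have := E 3%:R];
  rewrite !mxE.
Qed.

Lemma vec4P v : v = vec4 (v 0 0) (v 0 1) (v 0 2%:R) (v 0 3%:R).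
Proof.
apply/rowP; case=> [[|[|[|[|//]]]] ?]; rewrite mxE /=; congr (v 0 _); exact: val_inj.
Qed.

Definition ruling_line g lam a : {vspace 'rV[k]_4} :=
  <<[:: vec4 1 0 a 0 *m g; vec4 0 1 0 (lam * a) *m g]>>%VS.

Lemma mem_ruling_line g lam a v :
  reflect (exists s t, v = vec4 s t (a * s) (lam * a * t) *m g) (v \in ruling_line g lam a).
Proof.
have E s t : vec4 s t (a * s) (lam * a * t) *m g =
    s *: (vec4 1 0 a 0 *m g) + t *: (vec4 0 1 0 (lam * a) *m g).
  rewrite !scalemxAl -mulmxDl; congr (_ *m _); apply/rowP.
  by case=> [[|[|[|[|//]]]] ?]; rewrite !mxE /= ?mulr0 ?mulr1 ?addr0 ?add0r // mulrC.
apply: (iffP idP) => [|[s [t ->]]].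
  rewrite /ruling_line span_cons span_seq1 => /memv_addP[_ /vlineP[s ->] [_ /vlineP[t ->] ->]].
  by exists s, t; rewrite E.
by rewrite E /ruling_line span_cons span_seq1 memv_add ?rpredZ ?memv_line.
Qed.

Lemma meetsP (l m : {vspace 'rV[k]_4}) :
  reflect (exists2 v, v != 0 & (v \in l) && (v \in m)) (meets l m).
Proof.
rewrite /meets; apply: (iffP idP) => [lm|[v v0 vlm]].
  by exists (vpick (l :&: m)%VS); rewrite ?vpick0 // -memv_cap memv_pick.
by apply: contraNneq v0 => lm; rewrite -memv0 -lm memv_cap.
Qed.

Lemma meets_sym (l m : {vspace 'rV[k]_4}) : meets l m = meets m l.
Proof. by rewrite /meets capvC. Qed.

(* Exchanging e1 and e2 exchanges the two rulings of y0 y3 = lam y1 y2. *)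
Definition swap_frame g : 'M[k]_4 := tperm_mx 1 2%:R *m g.

Lemma vec4_swap x0 x1 x2 x3 g :
  vec4 x0 x1 x2 x3 *m swap_frame g = vec4 x0 x2 x1 x3 *m g.
Proof.
rewrite /swap_frame mulmxA -xcolE; congr (_ *m _); apply/rowP.
by case=> [[|[|[|[|//]]]] ?]; rewrite !mxE permE.
Qed.

Lemma swap_frameK : involutive swap_frame.
Proof.
by move=> g; rewrite /swap_frame -!xrowE; apply/matrixP=> i j; rewrite !mxE tpermK.
Qed.

Lemma swap_frame_unit g : g \in unitmx -> swap_frame g \in unitmx.
Proof. by move=> ug; rewrite unitmx_mul ug unitmx_perm. Qed.

Lemma mulmx_unit_eq0 g v : g \in unitmx -> (v *m g == 0) = (v == 0).
Proof. by move=> ug; rewrite -{1}(mul0mx _ g) (inj_eq (can_inj (mulmxK ug))). Qed.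

Lemma vec4_eq0 x0 x1 x2 x3 :
  (vec4 x0 x1 x2 x3 == 0) = [&& x0 == 0, x1 == 0, x2 == 0 & x3 == 0].
Proof.
have V0 : 0 = vec4 0 0 0 0 by apply/rowP; case=> [[|[|[|[|//]]]] ?]; rewrite !mxE.
apply/eqP/and4P => [|[/eqP-> /eqP-> /eqP-> /eqP->]//].
by rewrite V0 => /vec4_inj[-> -> -> ->].
Qed.

Lemma ruling_line_is_line g lam a : g \in unitmx -> is_line (ruling_line g lam a).
Proof.
move=> ug; rewrite /is_line -[2%N]/(size [:: vec4 1 0 a 0 *m g; vec4 0 1 0 (lam * a) *m g]).
rewrite -/(free _) free_cons span_seq1 free_cons span_nil memv0 nil_free andbT.
rewrite mulmx_unit_eq0 // vec4_eq0 oner_eq0 andbF /= andbT.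
apply/negP=> /vlineP[t]; rewrite scalemxAl => /(can_inj (mulmxK ug))/rowP/(_ 0).
by rewrite !mxE mulr0 => /eqP; rewrite oner_eq0.
Qed.

Lemma ruling_line_meets_opposite g lam a c : g \in unitmx ->
  meets (ruling_line g lam a) (ruling_line (swap_frame g) lam c).
Proof.
move=> ug; apply/meetsP; exists (vec4 1 c a (lam * a * c) *m g).
  by rewrite mulmx_unit_eq0 // vec4_eq0 oner_eq0.
apply/andP; split; apply/mem_ruling_line.
  by exists 1, c; rewrite mulr1.
by exists 1, a; rewrite vec4_swap mulr1 mulrAC.
Qed.

Lemma ruling_line_skew_opposite g lam mu a c : g \in unitmx -> lam != mu ->
  a != 0 -> c != 0 ->
  Defs.skew (ruling_line g lam a) (ruling_line (swap_frame g) mu c).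
Proof.
move=> ug lm a0 c0; apply/meetsP=> -[v v0 /andP[/mem_ruling_line[s [t vE]]]].
move/mem_ruling_line=> [s' [t']]; rewrite vec4_swap vE => /(can_inj (mulmxK ug)).
case/vec4_inj=> <- tE <- E; move: v0; rewrite vE mulmx_unit_eq0 // vec4_eq0 tE.
suff -> : s = 0 by rewrite !mulr0 eqxx.
have /eqP : (lam - mu) * (a * c * s) = 0.
  have -> : (lam - mu) * (a * c * s) = lam * a * (c * s) - mu * c * (a * s) by ring.
  by rewrite -E tE subrr.
by rewrite !mulf_eq0 subr_eq0 (negPf lm) (negPf a0) (negPf c0) => /eqP.
Qed.

(** In frame coordinates a common point with s != 0 forces a = b, and one with t != 0 forces lam a =
    mu b. *)
Lemma ruling_line_meets g lam mu a b : g \in unitmx ->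
  meets (ruling_line g lam a) (ruling_line g mu b) = (a == b) || (lam * a == mu * b).
Proof.
move=> ug; apply/meetsP/orP => [[v v0 /andP[/mem_ruling_line[s [t vE]]]]|[/eqP->|/eqP ab]].
- move/mem_ruling_line=> [s' [t']]; rewrite vE => /(can_inj (mulmxK ug)).
  case/vec4_inj=> <- <- Es Et; move: v0; rewrite vE mulmx_unit_eq0 // vec4_eq0.
  have [s0|s0 _] := eqVneq s 0; last by left; rewrite (mulIf s0 Es).
  have [t0|t0 _] := eqVneq t 0; first by rewrite s0 t0 !mulr0 eqxx.
  by right; rewrite (mulIf t0 Et).
- exists (vec4 1 0 b 0 *m g); first by rewrite mulmx_unit_eq0 // vec4_eq0 oner_eq0.
  by apply/andP; split; apply/mem_ruling_line; exists 1, 0; rewrite mulr1 !mulr0.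
- exists (vec4 0 1 0 (mu * b) *m g).
    by rewrite mulmx_unit_eq0 // vec4_eq0 oner_eq0 andbF.
  by apply/andP; split; apply/mem_ruling_line; exists 0, 1; rewrite !mulr1 !mulr0 ?ab.
Qed.

Lemma ruling_line_inj g lam : g \in unitmx -> lam != 0 -> injective (ruling_line g lam).
Proof.
move=> ug l0 a b E; have := ruling_line_meets lam lam a b ug.
have -> : meets (ruling_line g lam a) (ruling_line g lam b).
  by rewrite -E ruling_line_meets // eqxx.
by case/esym/orP=> /eqP // /(mulfI l0).
Qed.

(** * The double 2d of a frame and two parameters *)

Section DoubleOfFrame.

Variable N : {fset k}.

Definition ruling g lam : {fset {vspace 'rV[k]_4}} := [fset ruling_line g lam a | a in N]%fset.

Definition frame_half g lam mu := (ruling g lam `|` ruling (swap_frame g) mu)%fset.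

(** As [swap_frame] is an involution, the second half is D_lam U C_mu. *)
Definition frame_double g lam mu : {fset {fset {vspace 'rV[k]_4}}} :=
  [fset frame_half g lam mu; frame_half (swap_frame g) lam mu]%fset.

Hypothesis N0 : 0 \notin N.

Lemma N_neq0 a : a \in N -> a != 0.
Proof. by apply: contraTneq => ->. Qed.

Lemma rulingP g lam l :
  reflect (exists2 a, a \in N & l = ruling_line g lam a) (l \in ruling g lam).
Proof. by apply: (iffP (imfsetP _ _ _ _)) => -[a aN ->]; exists a. Qed.

Lemma card_ruling g lam : g \in unitmx -> lam != 0 -> #|` ruling g lam| = #|` N|.
Proof. by move=> ug l0; rewrite card_imfset //; apply: ruling_line_inj. Qed.

Lemma skew_rulings g lam mu l m : g \in unitmx -> lam != mu ->
  l \in ruling g lam -> m \in ruling (swap_frame g) mu -> Defs.skew l m.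
Proof.
by move=> ug lm /rulingP[a aN ->] /rulingP[c cN ->]; rewrite ruling_line_skew_opposite ?N_neq0.
Qed.

Lemma meets_self g lam l : g \in unitmx -> l \in ruling g lam -> meets l l.
Proof. by move=> ug /rulingP[a _ ->]; rewrite ruling_line_meets ?eqxx. Qed.

Lemma rulings_disjoint g lam mu : g \in unitmx -> lam != mu ->
  [disjoint ruling g lam & ruling (swap_frame g) mu]%fset.
Proof.
move=> ug lm; apply/fdisjointP=> l lC; apply/negP=> /(skew_rulings ug lm lC).
by rewrite /Defs.skew (meets_self ug lC).
Qed.

Lemma frame_half_lines g lam mu : g \in unitmx -> lam != 0 -> mu != 0 -> lam != mu ->
  set_of_lines (2 * #|` N|) (frame_half g lam mu).
Proof.
move=> ug l0 m0 lm; have usg := swap_frame_unit ug; split.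
  rewrite cardfsU disjoint_fsetI0 ?cardfs0 ?subn0 ?card_ruling ?mul2n ?addnn //.
  exact: rulings_disjoint.
by move=> l; rewrite inE => /orP[] /rulingP[a _ ->]; apply: ruling_line_is_line.
Qed.

Lemma ruling_pairwise_skew g lam : g \in unitmx -> lam != 0 -> pairwise_skew (ruling g lam).
Proof.
move=> ug l0 _ _ /rulingP[a _ ->] /rulingP[b _ ->] ab; rewrite /Defs.skew ruling_line_meets //.
by rewrite (inj_eq (mulfI l0)) orbb; apply: contraNneq ab => ->.
Qed.

Lemma frame_half_pairwise_skew g lam mu : g \in unitmx -> lam != 0 -> mu != 0 -> lam != mu ->
  pairwise_skew (frame_half g lam mu).
Proof.
move=> ug l0 m0 lm l m; rewrite !inE => /orP[] lC /orP[] mC.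
- exact: ruling_pairwise_skew lC mC.
- by move=> _; apply: skew_rulings lC mC.
- by move=> _; rewrite /Defs.skew meets_sym; apply: skew_rulings mC lC.
- exact: ruling_pairwise_skew (swap_frame_unit ug) m0 _ _ lC mC.
Qed.

(** The lines met are all of D_lam and the two lines of C_mu with parameters a and b = (lam / mu) a,
    distinct since lam != mu. *)
Lemma card_met_lines g lam mu l : g \in unitmx -> lam != 0 -> mu != 0 -> lam != mu ->
  {in N, forall a, lam / mu * a \in N} -> l \in ruling g lam ->
  #|` [fset m in ruling (swap_frame g) lam `|` ruling g mu | meets l m]%fset| = (#|` N| + 2)%N.
Proof.
move=> ug l0 m0 lm NM /rulingP[a aN ->].
have usg := swap_frame_unit ug.
pose b := lam / mu * a; have mub : mu * b = lam * a by rewrite /b mulrA mulrCA divff ?mulr1.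
have ab : a != b.
  apply: contraNneq lm => ab; apply/eqP; apply: (mulIf (N_neq0 aN)).
  by rewrite -mub -ab.
have -> : [fset m in ruling (swap_frame g) lam `|` ruling g mu | meets (ruling_line g lam a) m]%fset
   = (ruling (swap_frame g) lam `|` [fset ruling_line g mu a; ruling_line g mu b])%fset.
  apply/fsetP=> m; rewrite !inE; apply/andP/orP=> [[/orP[->|/rulingP[c cN ->]]]|]; first by left.
    rewrite ruling_line_meets // -mub (inj_eq (mulfI m0)) => /orP[] /eqP <-; rewrite eqxx ?orbT;
    by right.
  case=> [mC|/orP[]/eqP->].
  - by rewrite mC; case/rulingP: mC => c _ ->; rewrite ruling_line_meets_opposite.
  - rewrite ruling_line_meets // eqxx; split=> //; apply/orP; right.
    by apply/rulingP; exists a.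
  - rewrite ruling_line_meets // mub eqxx orbT; split=> //; apply/orP; right.
    by apply/rulingP; exists b; rewrite // NM.
rewrite cardfsU disjoint_fsetI0 ?cardfs0 ?subn0 ?card_ruling ?cardfs2 //.
  by rewrite (inj_eq (ruling_line_inj ug m0)) ab.
have mC c : c \in N -> ruling_line g mu c \in ruling g mu.
  by move=> cN; apply/rulingP; exists c.
have D c : c \in N -> ruling_line g mu c \notin ruling (swap_frame g) lam.
  move=> cN; apply: (fdisjointP (rulings_disjoint ug _) _ (mC c cN)).
  by rewrite eq_sym.
by rewrite fdisjointXU !fdisjointX1 ?D ?NM.
Qed.

Lemma frame_half_each_meets g lam mu : g \in unitmx -> lam != 0 -> mu != 0 -> lam != mu ->
  {in N, forall a, lam / mu * a \in N} -> {in N, forall a, mu / lam * a \in N} ->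
  each_meets (#|` N| + 2) (frame_half g lam mu) (frame_half (swap_frame g) lam mu).
Proof.
move=> ug l0 m0 lm NM NM' l; rewrite /frame_half swap_frameK inE => /orP[] lC.
  exact: card_met_lines.
(* A line of D_mu is handled in the swapped frame with lam and mu exchanged. *)
have := card_met_lines (swap_frame_unit ug) m0 l0 _ NM' lC.
by rewrite swap_frameK fsetUC; apply; rewrite eq_sym.
Qed.

Lemma frame_double_2d g lam mu : g \in unitmx -> lam != 0 -> mu != 0 -> lam != mu ->
  {in N, forall a, lam / mu * a \in N} -> {in N, forall a, mu / lam * a \in N} ->
  double_2d #|` N| (frame_double g lam mu).
Proof.
move=> ug l0 m0 lm NM NM'; have usg := swap_frame_unit ug.
exists (frame_half g lam mu), (frame_half (swap_frame g) lam mu); split=> //.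
- by split; apply: frame_half_lines.
- by split; apply: frame_half_pairwise_skew.
split; first exact: frame_half_each_meets.
by have := frame_half_each_meets usg l0 m0 lm NM NM'; rewrite swap_frameK.
Qed.

(** Describes the union of the two halves, which is all that the recovery of the frame uses. *)
Lemma frame_double_coverP g lam mu l :
  reflect (exists2 X, X \in frame_double g lam mu & l \in X)
    [|| l \in ruling g lam, l \in ruling (swap_frame g) lam, l \in ruling g mu
      | l \in ruling (swap_frame g) mu].
Proof.
apply: (iffP idP) => [|[X]]; last first.
  rewrite !inE => /orP[]/eqP->; rewrite /frame_half ?swap_frameK inE => /orP[] ->;
  by rewrite ?orbT.
case/or4P=> lC.
- by exists (frame_half g lam mu); rewrite !inE ?eqxx ?lC.
- by exists (frame_half (swap_frame g) lam mu); rewrite !inE ?eqxx ?lC ?orbT.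
- by exists (frame_half (swap_frame g) lam mu); rewrite !inE ?swap_frameK ?eqxx ?lC ?orbT.
- by exists (frame_half g lam mu); rewrite !inE ?eqxx ?lC ?orbT.
Qed.

End DoubleOfFrame.

End Rulings.

(** * Recovering the quadrics from the lines *)

Section Quadrics.

Variable k : fieldType.
Implicit Types (g h M : 'M[k]_4) (a b c lam mu nu s t : k) (v y : 'rV[k]_4).

Definition quadric4 lam y := y 0 0 * y 0 3%:R - lam * y 0 1 * y 0 2%:R.

Definition frame_quadric g lam v := quadric4 lam (v *m invmx g).

Lemma quadric4_vec4 lam x0 x1 x2 x3 :
  quadric4 lam (vec4 x0 x1 x2 x3) = x0 * x3 - lam * x1 * x2.
Proof. by rewrite /quadric4 !mxE. Qed.

Lemma frame_quadricE g lam x0 x1 x2 x3 : g \in unitmx ->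
  frame_quadric g lam (vec4 x0 x1 x2 x3 *m g) = x0 * x3 - lam * x1 * x2.
Proof. by move=> ug; rewrite /frame_quadric mulmxK // quadric4_vec4. Qed.

Lemma frame_quadric_ruling (N : {fset k}) g lam l v : g \in unitmx ->
  (l \in ruling N g lam) || (l \in ruling N (swap_frame g) lam) -> v \in l ->
  frame_quadric g lam v = 0.
Proof.
move=> ug /orP[] /rulingP[a _ ->] /mem_ruling_line[s [t ->]];
  rewrite ?vec4_swap frame_quadricE //; ring.
Qed.

(** By divided differences, which work in every characteristic. *)
Lemma quadratic_three_roots a0 a1 a2 b0 b1 b2 : b0 != b1 -> b0 != b2 -> b1 != b2 ->
  (forall b, b \in [:: b0; b1; b2] -> a0 + a1 * b + a2 * b ^+ 2 = 0) ->
  [/\ a0 = 0, a1 = 0 & a2 = 0].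
Proof.
move=> b01 b02 b12 E.
have E0 : a0 + a1 * b0 + a2 * b0 ^+ 2 = 0 by apply: E; rewrite !inE eqxx.
have E1 : a0 + a1 * b1 + a2 * b1 ^+ 2 = 0 by apply: E; rewrite !inE eqxx orbT.
have E2 : a0 + a1 * b2 + a2 * b2 ^+ 2 = 0 by apply: E; rewrite !inE eqxx !orbT.
have F1 : a1 + a2 * (b0 + b1) = 0.
  apply: (mulfI (x := b0 - b1)); first by rewrite subr_eq0.
  by rewrite mulr0 -(subrr 0) -{1}E0 -E1; ring.
have F2 : a1 + a2 * (b0 + b2) = 0.
  apply: (mulfI (x := b0 - b2)); first by rewrite subr_eq0.
  by rewrite mulr0 -(subrr 0) -{1}E0 -E2; ring.
have a20 : a2 = 0.
  apply: (mulfI (x := b1 - b2)); first by rewrite subr_eq0.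
  by rewrite mulr0 -(subrr 0) -{1}F1 -F2; ring.
have a10 : a1 = 0 by rewrite -F1 a20 mul0r addr0.
by split=> //; rewrite -E0 a20 a10 !mul0r !addr0.
Qed.

Lemma mul_vec4 x0 x1 x2 x3 M j :
  (vec4 x0 x1 x2 x3 *m M) 0 j = x0 * M 0 j + x1 * M 1 j + x2 * M 2%:R j + x3 * M 3%:R j.
Proof.
rewrite mxE !big_ord_recl big_ord0 !mxE /= addr0 !addrA.
by congr (_ * M _ _ + _ * M _ _ + _ * M _ _ + _ * M _ _); apply: val_inj.
Qed.

(* A ruling of a smooth quadric surface is a one-parameter family of lines on
   which the conditions "the quadratic form vanishes" are quadratic in the
   parameter, so three lines of a ruling determine the quadric. *)
Lemma three_lines_quadric g h nu lam b0 b1 b2 : h \in unitmx -> lam != 0 ->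
  b0 != b1 -> b0 != b2 -> b1 != b2 ->
  (forall b v, b \in [:: b0; b1; b2] -> v \in ruling_line h lam b -> frame_quadric g nu v = 0) ->
  exists c, forall v, frame_quadric g nu v = c * frame_quadric h lam v.
Proof.
move=> uh l0 b01 b02 b12 E; pose M := h *m invmx g.
(* [T i i] and [T2 i j] are the coefficients of the first quadric in the frame h; keeping [T2] as a
   sum avoids dividing by 2. *)
pose T i j := M i 0 * M j 3%:R - nu * M i 1 * M j 2%:R.
pose T2 i j := T i j + T j i.
have TE x0 x1 x2 x3 : frame_quadric g nu (vec4 x0 x1 x2 x3 *m h) =
    T 0 0 * x0 ^+ 2 + T 1 1 * x1 ^+ 2 + T 2%:R 2%:R * x2 ^+ 2 + T 3%:R 3%:R * x3 ^+ 2
    + T2 0 1 * x0 * x1 + T2 0 2%:R * x0 * x2 + T2 0 3%:R * x0 * x3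
    + T2 1 2%:R * x1 * x2 + T2 1 3%:R * x1 * x3 + T2 2%:R 3%:R * x2 * x3.
  by rewrite /frame_quadric -mulmxA -/M /quadric4 !mul_vec4 /T2 /T; ring.
have E' b s t : b \in [:: b0; b1; b2] ->
    frame_quadric g nu (vec4 s t (b * s) (lam * b * t) *m h) = 0.
  by move=> bb; apply: (E b) => //; apply/mem_ruling_line; exists s, t.
(* The points with (s, t) = (1, 0), (0, 1) and (1, 1) each give a quadratic in b with three roots;
   only the coefficients of x0 x3 and x1 x2 survive. *)
have [T00 T02 T22] : [/\ T 0 0 = 0, T2 0 2%:R = 0 & T 2%:R 2%:R = 0].
  apply: (quadratic_three_roots b01 b02 b12) => b bb.
  by rewrite -(E' b 1 0 bb) TE; ring.
have [T11 T13 T33] : [/\ T 1 1 = 0, lam * T2 1 3%:R = 0 & lam ^+ 2 * T 3%:R 3%:R = 0].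
  apply: (quadratic_three_roots b01 b02 b12) => b bb.
  by rewrite -(E' b 0 1 bb) TE; ring.
have [T01 T03 T23] : [/\ T2 0 1 = 0, T2 1 2%:R + lam * T2 0 3%:R = 0 & lam * T2 2%:R 3%:R = 0].
  apply: (quadratic_three_roots b01 b02 b12) => b bb.
  have := E' b 1 1 bb; rewrite TE T00 T02 T22 T11 => <-.
  have -> : T2 1 3%:R = 0 by apply: (mulfI l0); rewrite T13 mulr0.
  have -> : T 3%:R 3%:R = 0 by apply: (mulfI (expf_neq0 2 l0)); rewrite T33 mulr0.
  ring.
have T13' : T2 1 3%:R = 0 by apply: (mulfI l0); rewrite T13 mulr0.
have T33' : T 3%:R 3%:R = 0 by apply: (mulfI (expf_neq0 2 l0)); rewrite T33 mulr0.
have T23' : T2 2%:R 3%:R = 0 by apply: (mulfI l0); rewrite T23 mulr0.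
exists (T2 0 3%:R) => v; rewrite -(mulmxKV uh v) [v *m _]vec4P frame_quadricE // TE.
rewrite T00 T11 T22 T33' T01 T02 T13' T23'.
by rewrite (_ : T2 1 2%:R = - (lam * T2 0 3%:R)); [ring | apply/eqP; rewrite -addr_eq0 T03].
Qed.

(** Pigeonhole: among five parameters three agree on [p]. This is where d >= 5 enters. *)
Lemma three_in_fset (N : {fset k}) (p : pred k) : (5 <= #|` N|)%N ->
  exists b0 b1 b2, [/\ b0 != b1, b0 != b2 & b1 != b2] /\
    ((forall b, b \in [:: b0; b1; b2] -> (b \in N) && p b) \/
     (forall b, b \in [:: b0; b1; b2] -> (b \in N) && ~~ p b)).
Proof.
move=> N5; have three (r : seq k) : uniq r -> (2 < size r)%N -> exists b0 b1 b2,
    [/\ b0 != b1, b0 != b2 & b1 != b2] /\ {subset [:: b0; b1; b2] <= r}.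
  case: r => [|b0 [|b1 [|b2 r]]] //=;
    rewrite !inE !negb_or => /and4P[/and3P[b01 b02 _] /andP[b12 _] _ _] _.
  exists b0, b1, b2; split=> // b; rewrite !inE.
  by case/or3P=> ->; rewrite ?orbT.
have [lt|ge] := ltnP 2 (count p (enum_fset N)).
  have [||b0 [b1 [b2 [D S]]]] := three [seq x <- enum_fset N | p x].
  - by rewrite filter_uniq ?fset_uniq.
  - by rewrite size_filter.
  exists b0, b1, b2; split=> //; left=> b /S; by rewrite mem_filter andbC.
have [||b0 [b1 [b2 [D S]]]] := three [seq x <- enum_fset N | ~~ p x].
- by rewrite filter_uniq ?fset_uniq.
- rewrite size_filter ltnNge; apply/negP=> /(leq_add ge).
  by rewrite (count_predC p) => /(leq_trans N5).
exists b0, b1, b2; split=> //; right=> b /S; by rewrite mem_filter andbC.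
Qed.

Lemma frame_quadric_scale g h lam mu c : g \in unitmx -> h \in unitmx ->
  (forall v, frame_quadric g lam v = c * frame_quadric h mu v) ->
  c != 0 /\ forall v, frame_quadric h mu v = c^-1 * frame_quadric g lam v.
Proof.
move=> ug uh E; have c0 : c != 0.
  apply/eqP=> c0; have := E (vec4 1 0 0 1 *m g);
    rewrite c0 mul0r frame_quadricE // !mulr0 subr0 mulr1.
  by move/eqP; rewrite oner_eq0.
by split=> // v; rewrite E mulKf.
Qed.

(** Three of the lines lie on the same one of the two quadrics of g, which is then determined by
    them up to a scalar. *)
Lemma covered_ruling_quadric (N : {fset k}) g h lam mu nu : g \in unitmx -> h \in unitmx ->
  nu != 0 -> (5 <= #|` N|)%N ->
  (forall l, l \in ruling N h nu ->
    [|| l \in ruling N g lam, l \in ruling N (swap_frame g) lam, l \in ruling N g mu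
      | l \in ruling N (swap_frame g) mu]) ->
  exists2 rho, rho \in [:: lam; mu] &
    exists c, forall v, frame_quadric h nu v = c * frame_quadric g rho v.
Proof.
move=> ug uh n0 N5 cov.
pose p b := (ruling_line h nu b \in ruling N g lam) || (ruling_line h nu b \in ruling N
  (swap_frame g) lam).
have [b0 [b1 [b2 [[b01 b02 b12] [H|H]]]]] := three_in_fset p N5.
  exists lam; first by rewrite !inE eqxx.
  have [b v /H /andP[_ pb]|c /(frame_quadric_scale ug uh)[_ E]] := @three_lines_quadric g h lam
    nu b0 b1 b2 uh n0 b01 b02 b12.
    exact: (frame_quadric_ruling ug pb).
  by exists c^-1.
exists mu; first by rewrite !inE eqxx orbT.
have [b v /H /andP[bN pb]|c /(frame_quadric_scale ug uh)[_ E]] := @three_lines_quadric g h mu nu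
  b0 b1 b2 uh n0 b01 b02 b12.
  apply: (frame_quadric_ruling (N := N)) => //.
  have /cov : ruling_line h nu b \in ruling N h nu by apply/rulingP; exists b.
  by rewrite orbA -/(p b) (negPf pb).
by exists c^-1.
Qed.

(** The values at e0 + e3 and e1 + e2 fix the scalar and then the parameter. *)
Lemma frame_quadric_inj g h lam mu nu c c' : g \in unitmx -> h \in unitmx ->
  (forall v, frame_quadric h mu v = c * frame_quadric g lam v) ->
  (forall v, frame_quadric h nu v = c' * frame_quadric g lam v) -> mu = nu.
Proof.
move=> ug uh /(frame_quadric_scale uh ug)[c0 E] E'.
have E1 v : frame_quadric h nu v = c' * (c^-1 * frame_quadric h mu v) by rewrite E' E.
have := E1 (vec4 1 0 0 1 *m h); rewrite !frame_quadricE // !mulr0 !subr0 !mulr1 => E2.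
have := E1 (vec4 0 1 1 0 *m h); rewrite !frame_quadricE // mulrA -E2.
by rewrite !mul0r !sub0r !mulr1 mul1r => /oppr_inj.
Qed.

End Quadrics.

(** * Changes of frame preserving the pencil of quadrics *)

Section Monomial.

Variable k : fieldType.
Implicit Types (g h M : 'M[k]_4) (c lam mu : k) (y : 'rV[k]_4).

(** u and w are the coefficients of two linear forms whose product involves only y0 y3 and y1 y2
    ([rev_ord] exchanges 0 with 3 and 1 with 2). Where u_i != 0, every w_r with r != [rev_ord i]
    must vanish, and symmetrically. *)
Lemma linear_forms_support (u w : 'I_4 -> k) :
  (forall i, u i * w i = 0) ->
  (forall i j, i != j -> j != rev_ord i -> u i * w j + u j * w i = 0) ->
  (exists i, u i != 0) -> (exists i, w i != 0) ->
  exists i, (forall r, r != i -> u r = 0) /\ (forall r, r != rev_ord i -> w r = 0).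
Proof.
move=> uw0 uwx [i ui] [l wl]; exists i.
have w0 r : r != rev_ord i -> w r = 0.
  move=> rri; apply: (mulfI ui); rewrite mulr0.
  have [->|ri] := eqVneq r i; first exact: uw0.
  have wi : w i = 0 by apply: (mulfI ui); rewrite uw0 mulr0.
  by have := uwx i r; rewrite eq_sym ri rri wi mulr0 addr0 => ->.
split=> // r ri.
have wri : w (rev_ord i) != 0.
  by apply: contraNneq wl => wri; have [->|/w0->] := eqVneq l (rev_ord i); rewrite ?wri.
apply: (mulIf wri); rewrite mul0r.
have [->|rri] := eqVneq r (rev_ord i); first exact: uw0.
have := uwx r (rev_ord i) rri; rewrite (inj_eq rev_ord_inj) eq_sym ri => /(_ isT).
by rewrite (w0 r rri) mulr0 addr0.
Qed.

Lemma quadric4_delta lam i : quadric4 lam (delta_mx 0 i) = 0.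
Proof.
by case: i => [[|[|[|[|//]]]] ?]; rewrite /quadric4 !mxE /= ?(mulr0, mul0r, subr0).
Qed.

Lemma quadric4_delta2 lam i j : i != j -> j != rev_ord i ->
  quadric4 lam (delta_mx 0 i + delta_mx 0 j) = 0.
Proof.
case: i => [[|[|[|[|//]]]] ?]; case: j => [[|[|[|[|//]]]] ?] // _ _;
by rewrite /quadric4 !mxE /= ?(mulr0, mul0r, add0r, addr0, subr0, oppr0).
Qed.

Definition outer (i : 'I_4) := (i == 0) || (i == 3%:R).

(* The eight permutations preserving {{0, 3}, {1, 2}}: [i] is the image of 0 and
   [b] selects one of the two possible images of 1. *)
Definition frame_perm (i : 'I_4) (b : bool) (s : 'I_4) : 'I_4 :=
  let j := nth ord0 (if outer i then [:: 1; 2%:R] else [:: 0; 3%:R]) b in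
  nth ord0 [:: i; j; rev_ord j; rev_ord i] s.

Definition frame_change (i : 'I_4) (b : bool) (m : 'I_4 -> k) : 'M[k]_4 :=
  \matrix_(r, s) (m s *+ (r == frame_perm i b s)).

(** If the permutation exchanges the pairs {0, 3} and {1, 2}, the products y0 y3 and y1 y2 trade
    places, which inverts the parameter. *)
Definition param_change (i : 'I_4) (m : 'I_4 -> k) lam :=
  let rho := m 0 * m 3%:R / (m 1 * m 2%:R) in if outer i then rho * lam else rho / lam.

Lemma unitmx_col_neq0 n (M : 'M[k]_n) s : M \in unitmx -> exists r, M r s != 0.
Proof.
move=> uM; apply/existsP; apply: contraTT uM; rewrite negb_exists => /forallP M0.
rewrite -unitmx_tr; apply/negP=> uMT.
have : row s M^T = 0.
  by apply/rowP=> r; rewrite !mxE; apply/eqP; have := M0 r; rewrite negbK.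
rewrite rowE => /(canRL (mulmxK uMT)); rewrite mul0mx => /matrixP/(_ 0 s).
by rewrite !mxE !eqxx /= => /eqP; rewrite oner_eq0.
Qed.

Lemma frame_permE i j : outer i != outer j ->
  exists b, forall s, frame_perm i b s = nth ord0 [:: i; j; rev_ord j; rev_ord i] s.
Proof.
move=> ij; exists ((j == 2%:R) || (j == 3%:R)) => s.
suff jE : nth ord0 (if outer i then [:: 1; 2%:R] else [:: 0;
  3%:R]) ((j == 2%:R) || (j == 3%:R)) = j.
  by rewrite /frame_perm jE.
by apply: val_inj; case: i ij => [[|[|[|[|//]]]] ?]; case: j => [[|[|[|[|//]]]] ?].
Qed.

Lemma frame_change_params i b m c lam lam' : (forall s, m s != 0) -> lam != 0 ->
  (forall y, quadric4 lam' (y *m frame_change i b m) = c * quadric4 lam y) ->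
  lam' = param_change i m lam.
Proof.
move=> m_neq0 l0 E.
have rowM r s : ((delta_mx 0 r : 'rV[k]_4) *m frame_change i b m) 0 s = m s *+ (r == frame_perm i
  b s).
  by rewrite -rowE !mxE.
(* Evaluation at e0 + e3 and e1 + e2 isolates the two coefficients of the quadric. *)
have E03 := E (delta_mx 0 0 + delta_mx 0 3%:R).
have E12 := E (delta_mx 0 1 + delta_mx 0 2%:R).
rewrite /quadric4 !mulmxDl ![((_ : 'rV[k]_4) + _) 0 _]mxE !rowM !mxE /= in E03 E12.
have := (m_neq0 0, m_neq0 1, m_neq0 2%:R, m_neq0 3%:R).
rewrite /param_change; move: E03 E12 {E rowM m_neq0}.
case: i b => [[|[|[|[|//]]]] ?] [];
rewrite /outer /frame_perm /= ?(mulr0, mul0r, add0r, addr0, subr0, sub0r, mulr1, mul1r);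
move=> E03 E12 [[[n0 n1] n2] n3];
apply: (mulIf (mulf_neq0 n1 n2)); apply: oppr_inj; rewrite mulrA E12 -E03; field;
  by rewrite ?n1 ?n2 ?l0.
Qed.

(** Since lam' != mu', the coefficient conditions hold separately for the pullbacks of y0 y3 and y1
    y2; each is a product of two linear forms, the columns of M, to which [linear_forms_support]
    applies. *)
Lemma monomial_of_quadrics M lam mu lam' mu' c c' : M \in unitmx -> lam' != mu' ->
  lam != 0 -> mu != 0 ->
  (forall y, quadric4 lam' (y *m M) = c * quadric4 lam y) ->
  (forall y, quadric4 mu' (y *m M) = c' * quadric4 mu y) ->
  exists i b, let m s := M (frame_perm i b s) s in
    [/\ M = frame_change i b m, forall s, m s != 0,
        lam' = param_change i m lam & mu' = param_change i m mu].
Proof.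
move=> uM lm l0 m0 El Em.
have rowM i s : ((delta_mx 0 i : 'rV[k]_4) *m M) 0 s = M i s by rewrite -rowE mxE.
have split0 (x z : k) : x - lam' * z = 0 -> x - mu' * z = 0 -> x = 0 /\ z = 0.
  move=> xl xm; suff z0 : z = 0 by split=> //; rewrite -xl z0 mulr0 subr0.
  apply: (mulfI (x := mu' - lam')); first by rewrite subr_eq0 eq_sym.
  by rewrite mulr0 mulrBl -(subrr 0) -{1}xl -xm; ring.
have diag i : M i 0 * M i 3%:R = 0 /\ M i 1 * M i 2%:R = 0.
  apply: split0; [have := El (delta_mx 0 i) | have := Em (delta_mx 0 i)];
  by rewrite quadric4_delta mulr0 /quadric4 !rowM mulrA.
have cross i j : i != j -> j != rev_ord i ->
    M i 0 * M j 3%:R + M j 0 * M i 3%:R = 0 /\ M i 1 * M j 2%:R + M j 1 * M i 2%:R = 0.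
  move=> ij jri; have [di di'] := diag i; have [dj dj'] := diag j.
  apply: split0; [have := El (delta_mx 0 i + delta_mx 0 j) | have := Em (delta_mx 0 i + delta_mx
    0 j)];
  rewrite quadric4_delta2 // mulr0 /quadric4 mulmxDl ![((_ : 'rV[k]_4) + _) 0 _]mxE !rowM => E.
  - have -> : M i 0 * M j 3%:R + M j 0 * M i 3%:R - lam' * (M i 1 * M j 2%:R + M j 1 * M i 2%:R) =
      (M i 0 + M j 0) * (M i 3%:R + M j 3%:R) - lam' * (M i 1 + M j 1) * (M i 2%:R + M j 2%:R)
      - (M i 0 * M i 3%:R + M j 0 * M j 3%:R) + lam' * (M i 1 * M i 2%:R + M j 1 * M j 2%:R) by
        ring.
    by rewrite E di dj di' dj' !addr0 mulr0 subrr addr0.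
  - have -> : M i 0 * M j 3%:R + M j 0 * M i 3%:R - mu' * (M i 1 * M j 2%:R + M j 1 * M i 2%:R) =
      (M i 0 + M j 0) * (M i 3%:R + M j 3%:R) - mu' * (M i 1 + M j 1) * (M i 2%:R + M j 2%:R)
      - (M i 0 * M i 3%:R + M j 0 * M j 3%:R) + mu' * (M i 1 * M i 2%:R + M j 1 * M j 2%:R) by ring.
    by rewrite E di dj di' dj' !addr0 mulr0 subrr addr0.
have [i [Mi0 Mi3]] := linear_forms_support (fun i => (diag i).1)
  (fun i j ij ji => (cross i j ij ji).1) (unitmx_col_neq0 0 uM) (unitmx_col_neq0 3%:R uM).
have [j [Mj1 Mj2]] := linear_forms_support (fun i => (diag i).2)
  (fun i j ij ji => (cross i j ij ji).2) (unitmx_col_neq0 1 uM) (unitmx_col_neq0 2%:R uM).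
have [b bE] : exists b, forall s, frame_perm i b s = nth ord0 [:: i; j; rev_ord j; rev_ord i] s.
  (* If i and j lay in the same pair, the row of M with an index r from the other pair would be
     zero. *)
  apply: frame_permE; apply/negP=> /eqP ij.
  pose r : 'I_4 := if outer i then 1 else 0.
  have [s] := unitmx_col_neq0 r (etrans (unitmx_tr M) uM); rewrite mxE; apply/negP; rewrite negbK.
  have [ri rri rj rrj] : [/\ r != i, r != rev_ord i, r != j & r != rev_ord j].
    by rewrite /r; case: i ij {Mi0 Mi3 r} => [[|[|[|[|//]]]] ?];
      case: j {Mj1 Mj2} => [[|[|[|[|//]]]] ?].
  apply/eqP; case: s => [[|[|[|[|//]]]] p].
  - by rewrite -(Mi0 r ri); congr (M _ _); apply: val_inj.
  - by rewrite -(Mj1 r rj); congr (M _ _); apply: val_inj.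
  - by rewrite -(Mj2 r rrj); congr (M _ _); apply: val_inj.
  - by rewrite -(Mi3 r rri); congr (M _ _); apply: val_inj.
exists i, b; set m := fun s => _.
have M0 r s : r != frame_perm i b s -> M r s = 0.
  rewrite bE; case: s => [[|[|[|[|//]]]] p] /= rs.
  - by rewrite -(Mi0 r rs); congr (M _ _); apply: val_inj.
  - by rewrite -(Mj1 r rs); congr (M _ _); apply: val_inj.
  - by rewrite -(Mj2 r rs); congr (M _ _); apply: val_inj.
  - by rewrite -(Mi3 r rs); congr (M _ _); apply: val_inj.
have ME : M = frame_change i b m.
  apply/matrixP=> r s; rewrite mxE; case: eqVneq => [->|/M0->] //; by rewrite mulr1n.
have m0' s : m s != 0.
  have [r] := unitmx_col_neq0 s uM; have [->//|/M0->] := eqVneq r (frame_perm i b s).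
  by rewrite eqxx.
split=> //; [apply: (frame_change_params (b := b) (c := c)) => // y |
             apply: (frame_change_params (b := b) (c := c')) => // y]; by rewrite -ME.
Qed.

End Monomial.

(** * Triples giving the same double *)

Section Fibres.

Variables (k : fieldType) (q : nat) (hq : [pchar k].-nat q).
Local Notation "A ^f" := (map_mx (frob hq) A).

Lemma unitary_swap_frame (A g : 'M[k]_4) : g^f *m A *m g^T = 1%:M ->
  (swap_frame g)^f *m A *m (swap_frame g)^T = 1%:M.
Proof.
move=> gA; rewrite map_mxM trmx_mul map_tperm_mx tr_tperm_mx -!mulmxA (mulmxA A) (mulmxA g^f).
by rewrite (mulmxA g^f) gA mul1mx -xrowE; apply/matrixP=> i j; rewrite !mxE tpermK.
Qed.

Lemma unitary_frame_unit (A g : 'M[k]_4) : g^f *m A *m g^T = 1%:M -> g \in unitmx.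
Proof. by case/mulmx1_unit=> _; rewrite unitmx_tr. Qed.

Lemma frame_change_norm i b (m : 'I_4 -> k) :
  (frame_change i b m)^f *m (frame_change i b m)^T = 1%:M -> forall s, m s ^+ q.+1 = 1.
Proof.
move/mulmx1C => E s; have := congr1 (fun B : 'M_4 => B s s) E; rewrite !mxE eqxx mulr1n => E1;
  rewrite -[RHS]E1.
rewrite (bigD1 (frame_perm i b s)) //= big1 ?addr0 => [|r rs].
  by rewrite !mxE eqxx mulr1n exprS.
by rewrite !mxE (negPf rs) mul0r.
Qed.

(** The data (sw, i, b, m) take at most 2 * 4 * 2 * (q + 1)^4 = 16 (q + 1)^4 values. The matrix M =
    g h^(-1) carries one pair of quadrics to the other, hence is monomial; being unitary, it has
    nonzero entries of norm 1. *)
Lemma frame_double_fibre (N : {fset k}) (A g h : 'M[k]_4) (lam mu lam' mu' : k) :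
  (5 <= #|` N|)%N -> g^f *m A *m g^T = 1%:M -> h^f *m A *m h^T = 1%:M ->
  lam != 0 -> mu != 0 -> lam' != 0 -> mu' != 0 -> lam' != mu' ->
  frame_double N g lam mu = frame_double N h lam' mu' ->
  exists (sw : bool) i b (m : 'I_4 -> k),
    [/\ forall s, m s ^+ q.+1 = 1, h = invmx (frame_change i b m) *m g,
        lam' = param_change i m (if sw then mu else lam) &
        mu' = param_change i m (if sw then lam else mu)].
Proof.
move=> N5 gA hA l0 m0 l0' m0' lm' E.
have ug := unitary_frame_unit gA; have uh := unitary_frame_unit hA.
have cov l : (l \in ruling N h lam') || (l \in ruling N h mu') ->
    [|| l \in ruling N g lam, l \in ruling N (swap_frame g) lam, l \in ruling N g mu
      | l \in ruling N (swap_frame g) mu].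
  move=> lC; apply/frame_double_coverP; rewrite E; apply/frame_double_coverP.
  by case/orP: lC => ->; rewrite ?orbT.
have [l lC|rho rho_in [c Ec]] := covered_ruling_quadric ug uh l0' N5 (lam := lam) (mu := mu).
  by apply: cov; rewrite lC.
have [l lC|rho' rho_in' [c' Ec']] := covered_ruling_quadric ug uh m0' N5 (lam := lam) (mu := mu).
  by apply: cov; rewrite lC orbT.
have rr : rho != rho'.
  apply: contraNneq lm' => rr; apply/eqP; rewrite rr in Ec.
  exact: frame_quadric_inj ug uh Ec Ec'.
(* Two distinct members of {lam, mu} exhaust it, in one of two orders. *)
have [sw [rhoE rhoE']] : exists sw : bool, rho = (if sw then mu else lam) /\
    rho' = (if sw then lam else mu).
  move: rho_in rho_in' rr; rewrite !inE => /orP[]/eqP-> /orP[]/eqP->; rewrite ?eqxx // => _;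
  by [exists false | exists true].
pose M := g *m invmx h.
have uM : M \in unitmx by rewrite unitmx_mul ug unitmx_inv.
have Mh : M *m h = g by rewrite mulmxKV.
have trans nu sigma d : (forall v, frame_quadric h nu v = d * frame_quadric g sigma v) ->
    forall y, quadric4 nu (y *m M) = d * quadric4 sigma y.
  by move=> Eq y; have := Eq (y *m g); rewrite /frame_quadric mulmxK // -mulmxA.
have r0 : rho != 0 by rewrite rhoE; case: (sw).
have r0' : rho' != 0 by rewrite rhoE'; case: (sw).
have [i [b]] := monomial_of_quadrics uM lm' r0 r0' (trans _ _ _ Ec) (trans _ _ _ Ec').
set m := fun s => M _ s => -[ME m_neq0 El Em]; exists sw, i, b, m.
rewrite -rhoE -rhoE' -ME; split=> //; last by rewrite -Mh mulKmx.
apply: (frame_change_norm (i := i) (b := b)); rewrite -ME.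
rewrite -gA; symmetry;
  rewrite -[in LHS]Mh map_mxM trmx_mul -!mulmxA (mulmxA A) (mulmxA h^f) (mulmxA h^f).
by rewrite hA mul1mx.
Qed.

End Fibres.

(** The fibre of f through x lies among the values [decode x c], so it has at most #|C| elements. *)
Lemma size_le_fibres (P T : eqType) (C : finType) (f : P -> T) (s : seq P) (decode : P -> C -> P) :
  uniq s -> {in s &, forall x y, f x = f y -> exists c, y = decode x c} ->
  (size s <= #|C| * size (undup (map f s)))%N.
Proof.
move=> us dec; have -> : size s = (\sum_(y <- undup (map f s)) count (fun x => f x == y) s)%N.
  transitivity (\sum_(x <- s) \sum_(y <- undup (map f s)) (f x == y))%N.
    rewrite -sum1_size; apply: eq_big_seq => x xs.
    rewrite (bigD1_seq (f x)) ?undup_uniq ?mem_undup ?map_f //= eqxx big1 // => y.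
    by rewrite eq_sym => /negPf->.
  by rewrite exchange_big /=; apply: eq_bigr => y _; rewrite -big_mkcond sum1_count.
apply: (@leq_trans (\sum_(y <- undup (map f s)) #|C|)%N); last first.
  by rewrite big_const_seq count_predT iter_addn_0.
rewrite big_seq [X in (_ <= X)%N]big_seq; apply: leq_sum => y.
rewrite mem_undup => /mapP[x xs ->]; rewrite -size_filter.
have -> : #|C| = size [seq decode x c | c <- enum C] by rewrite size_map -cardE.
apply: uniq_leq_size; first by rewrite filter_uniq.
move=> z; rewrite mem_filter => /andP[/eqP fz zs].
have [c ->] := dec x z xs zs (esym fz).
by rewrite map_f ?mem_enum.
Qed.

(** * Frobenius forms as matrices *)

Section FrobeniusForms.

Variables (k : fieldType) (q : nat) (hq : [pchar k].-nat q) (q1 : (1 < q)%N).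
Local Notation "A ^f" := (map_mx (frob hq) A).

Lemma linear_form_coef n (L : {mpoly k[n]}) : L \is 1.-homog ->
  exists a : 'I_n -> k, L = \sum_(j < n) a j *: 'X_j.
Proof.
move=> hL; exists (fun j => L@_U_(j)).
apply/mpolyP=> m; rewrite raddf_sum /=.
under eq_bigr => j _ do rewrite mcoeffZ mcoeffX.
have [/eqP m1|m1] := boolP (mdeg m == 1%N).
  have [j /eqP ->] : exists j : 'I_n, m == U_(j)%MM by apply/mdeg1P/eqP.
  rewrite (bigD1 j) //= eqxx mulr1 big1 ?addr0 // => i ij.
  by rewrite eq_mnm1 (negPf ij) mulr0.
rewrite big1 => [|j _]; last first.
  case: eqVneq => [Um|_]; last by rewrite mulr0.
  by move: m1; rewrite -Um mdeg1.
by apply: memN_msupp_eq0; apply: contra m1 => /(dhomogP _ _ _ hL) ->.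
Qed.

Lemma mderiv_Xn_pchar n (i j : 'I_n) : ('X_i ^+ q : {mpoly k[n]})^`M(j) = 0.
Proof.
by rewrite mpolyXn mderivX mulmnE natrM (nat_pchar0 hq q1) mulr0 scale0r.
Qed.

(** A collects the coefficients of the linear forms. The factors x_i^q have zero derivative, so the
    gradient of F at v is v^[q] A. *)
Lemma Frobenius_formP (F : {mpoly k[4]}) : Frobenius_form q F ->
  exists A : 'M[k]_4, (forall v, (v^f *m A *m v^T) = (evalv F v)%:M) /\
    (forall j v, evalv F^`M(j) v = (v^f *m A) 0 j).
Proof.
case=> L [hL FE]; have /fin_all_exists[a LE] := fun i => linear_form_coef (hL i).
exists (\matrix_(i, j) a i j); split=> [v|j v].
  rewrite [LHS]mx11_scalar; congr (_%:M); rewrite /evalv FE raddf_sum /= -mulmxA mxE.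
  apply: eq_bigr => i _; rewrite mevalM rmorphXn /= mevalXU !mxE /frob; congr (_ * _).
  rewrite LE raddf_sum; apply: eq_bigr => j _.
  by rewrite /= mevalZ mevalXU !mxE.
have mderiv_sum (G : 'I_4 -> {mpoly k[4]}) : (\sum_(i < 4) G i)^`M(j) = \sum_(i < 4) (G i)^`M(j).
  exact: raddf_sum.
rewrite /evalv FE mderiv_sum raddf_sum mxE; apply: eq_bigr => i _ /=.
rewrite mderivM mderiv_Xn_pchar mul0r add0r mevalM rmorphXn /= mevalXU !mxE /frob; congr (_ * _).
rewrite LE mderiv_sum raddf_sum (bigD1 j) //= big1 ?addr0 => [|l lj].
  rewrite mderivZ mderivX mnm1E eqxx scale1r mevalZ (_ : (U_(j) - U_(j))%MM = 0%MM) ?mpolyX0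
    ?meval1 ?mulr1 ?mxE //.
  by apply/mnmP=> l; rewrite mnmBE subnn mnm0E.
by rewrite mderivZ mderivX mnm1E (negPf lj) scale0r scaler0 meval0.
Qed.

End FrobeniusForms.

(** In a unitary frame the form is the sum of the y_i^(q+1), which on the line equals (1 + a^(q+1))
    s^(q+1) + (1 + lam^(q+1) a^(q+1)) t^(q+1). *)
Lemma ruling_line_isotropic (k : fieldType) (q : nat) (hq : [pchar k].-nat q)
    (A g : 'M[k]_4) (lam a : k) v :
  map_mx (frob hq) g *m A *m g^T = 1%:M -> a ^+ q.+1 = -1 -> lam ^+ q.+1 = 1 ->
  v \in ruling_line g lam a -> map_mx (frob hq) v *m A *m v^T = 0.
Proof.
move=> gA aN lN /mem_ruling_line[s [t ->]]; set y := vec4 _ _ _ _.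
rewrite map_mxM trmx_mul -!mulmxA (mulmxA A) (mulmxA (map_mx _ g)) (mulmxA (map_mx _ g)) gA mul1mx.
rewrite [LHS]mx11_scalar mxE !big_ord_recl big_ord0 !mxE /= /frob !exprMn -!exprSr.
rewrite [X in X%:M](_ : _ = 0) ?raddf0 //.
rewrite -[RHS](_ : (1 + a ^+ q.+1) * s ^+ q.+1 + (1 + lam ^+ q.+1 * a ^+ q.+1) * t ^+ q.+1 = 0).
  rewrite !exprS; ring.
by rewrite aN lN mul1r subrr !mul0r addr0.
Qed.

(** The product is the order of U_4(q), and (q + 1) q counts the ordered pairs of distinct
    parameters. *)
Lemma unitary_group_card (q : nat) : (1 < q)%N ->
  (\prod_(1 <= i < 5) (sphere_card q i).2)%N%:R * (q.+1%:R * q%:R) =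
  (q%:R ^+ 3 + 1) * (q%:R ^+ 2 + 1) * (q%:R - 1) ^+ 2 * q%:R ^+ 7 * q.+1%:R ^+ 4 :> rat.
Proof.
(* Writing q = r + 2 makes [q.-1] and [q.-2] genuine differences; x is q as a rational number. *)
case: q => [|[|r]] // _; set q := r.+2; pose x : rat := r%:R + 2%:R.
have step n : (sphere_card q n.+1).1%:R =
      (sphere_card q n).1%:R + (x - 1) * (x + 1) * (sphere_card q n).2%:R :> rat /\
    (sphere_card q n.+1).2%:R = (x + 1) * (sphere_card q n).1%:R +
      (sphere_card q n).2%:R + (x - 2%:R) * (x + 1) * (sphere_card q n).2%:R :> rat.
  have xr : x - 2%:R = r%:R by rewrite addrK.
  have xr1 : x - 1 = r.+1%:R by rewrite /x -natr1; ring.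
  have xr3 : x + 1 = q.+1%:R by rewrite -!natr1 /x; ring.
  rewrite xr xr1 xr3 /=; case: (sphere_card q n) => a b /=.
  rewrite !natrD !natrM -!natr1 /x; split; ring.
have [a1 b1] := step 0%N; have [a2 b2] := step 1%N.
have [a3 b3] := step 2%N; have [_ b4] := step 3%N.
have [a0 b0] : (sphere_card q 0).1%:R = 1 :> rat /\ (sphere_card q 0).2%:R = 0 :> rat by [].
have -> : (\prod_(1 <= i < 5) (sphere_card q i).2 = (sphere_card q 1).2 * (sphere_card q 2).2 *
    (sphere_card q 3).2 * (sphere_card q 4).2)%N.
  by rewrite unlock /= !mulnA muln1.
rewrite !natrM b4 b3 a3 b2 a2 b1 a1 b0 a0 -!natr1 /x; ring.
Qed.

(** * Counting doubles on the surface *)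

Section Configurations.

Variables (k : closedFieldType) (q : nat) (hq : [pchar k].-nat q) (q4 : (4 <= q)%N).
Local Notation "A ^f" := (map_mx (frob hq) A).

Let q1 : (1 < q)%N.
Proof. exact: leq_trans q4. Qed.

(** A row killed by A is of the form w^[q], and a nonzero such w would be a singular point. *)
Lemma smooth_matrix_unit (F : {mpoly k[4]}) (A : 'M[k]_4) : smooth_surface F ->
  (forall v, v^f *m A *m v^T = (evalv F v)%:M) ->
  (forall j v, evalv F^`M(j) v = (v^f *m A) 0 j) -> A \in unitmx.
Proof.
move=> smF FE dF; rewrite -row_free_unit -kermx_eq0; apply/eqP/row_matrixP=> i.
rewrite row0; set v := row i _; have vA : v *m A = 0 by rewrite -row_mul mulmx_ker row0.
have [w wv] := frob_mx_surj hq q1 v; rewrite -wv.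
have [->|w0] := eqVneq w 0; first by rewrite map_mx0.
have [|j] := smF w w0; last by rewrite dF wv vA mxE eqxx.
by have /matrixP/(_ 0 0) := FE w; rewrite wv vA mul0mx !mxE.
Qed.

Lemma frame_doubles_on_surface (F : {mpoly k[4]}) (A : 'M[k]_4) :
  A \in unitmx -> (forall v, v^f *m A *m v^T = (evalv F v)%:M) ->
  exists S : {fset {fset {fset {vspace 'rV[k]_4}}}},
    (forall D, D \in S -> double_2d q.+1 D /\ contained_in D F) /\
    (\prod_(1 <= i < 5) (sphere_card q i).2 * (q.+1 * q) <= 16 * q.+1 ^ 4 * #|` S|)%N.
Proof.
move=> uA FE; have [g0 g0A] := unitary_basis hq q1 uA.
have qn0 := q1_neq0 hq q1.
have [U [uU /allP UP szU]] := unitary_seq hq q1 4.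
have [L [uL szL LE]] := roots_Xnsubc qn0 (oner_neq0 k).
have N1 : (-1 : k) != 0 by rewrite oppr_eq0 oner_eq0.
have [n [un szn nE]] := roots_Xnsubc qn0 N1.
pose N := [fset x in n]%fset.
have NE a : (a \in N) = (a ^+ q.+1 == -1) by rewrite inE nE.
have cN : #|` N| = q.+1 by rewrite card_fseq undup_id.
have L0 l : l \in L -> l != 0.
  by rewrite LE; apply: contraTneq => ->; rewrite expr0n eq_sym oner_eq0.
have N0 : 0 \notin N by rewrite NE expr0n eq_sym.
pose pairs := [seq (l, m) | l <- L, m <- rem l L].
have pairsP lm : lm \in pairs -> [/\ lm.1 \in L, lm.2 \in L & lm.1 != lm.2].
  case/allpairsPdep=> l [m [lL]]; rewrite mem_rem_uniq // !inE => /andP[ml mL] -> /=.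
  by rewrite eq_sym.
have upairs : uniq pairs.
  apply: uniq_allpairs_dep => // [l _|l l' m m' _ _ _ _ [-> ->] //].
  exact: rem_uniq.
have szpairs : size pairs = (q.+1 * q)%N.
  rewrite size_allpairs_dep sumnE big_map (eq_big_seq (fun=> q)) => [|l lL].
    by rewrite big_const_seq count_predT iter_addn_0 szL mulnC.
  by rewrite size_rem // szL.
pose s := [seq (u *m g0, lm) | u <- U, lm <- pairs].
have sP x : x \in s -> [/\ x.1^f *m A *m x.1^T = 1%:M, x.2.1 \in L, x.2.2 \in L & x.2.1 != x.2.2].
  case/allpairsP=> -[u lm] /= [/UP/eqP uu /pairsP[lL mL nlm] ->] /=; split=> //.
  rewrite map_mxM trmx_mul -!mulmxA (mulmxA A) (mulmxA g0^f) (mulmxA g0^f) g0A mul1mx.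
  exact: uu.
have us : uniq s.
  have ug0 := unitary_frame_unit g0A.
  by apply: allpairs_uniq => // -[u lm] [u' lm'] _ _ /= [/(can_inj (mulmxK ug0))-> ->].
pose f (x : 'M[k]_4 * (k * k)) := frame_double N x.1 x.2.1 x.2.2.
(* The entries m are taken in the list L of elements of norm 1, which makes C finite of cardinality
   16 (q + 1)^4. *)
pose C := (bool * 'I_4 * bool * {ffun 'I_4 -> seq_sub L})%type.
pose decode (x : 'M[k]_4 * (k * k)) (c : C) : 'M[k]_4 * (k * k) :=
  let: (sw, i, b, m) := c in let m' s := val (m s) in
  (invmx (frame_change i b m') *m x.1,
   (param_change i m' (if sw then x.2.2 else x.2.1), param_change i m' (if sw then x.2.1 else
     x.2.2))).
have N5 : (5 <= #|` N|)%N by rewrite cN.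
have fibre : {in s &, forall x y, f x = f y -> exists c, y = decode x c}.
  move=> [g [l m]] [h [l' m']] /sP[/= gA lL mL neq_lm] /sP[/= hA lL' mL' neq_lm'] E.
  have [sw [i [b [w [w1 hE lE mE]]]]] := frame_double_fibre N5 gA hA (L0 _ lL) (L0 _ mL) (L0 _
    lL') (L0 _ mL') neq_lm' E.
  have wL r : w r \in L by rewrite LE w1.
  exists (sw, i, b, [ffun r => SeqSub (wL r)]).
  rewrite /decode; set w' := fun r => _; have w'E r : w' r = w r by rewrite /w' ffunE.
  rewrite (_ : frame_change i b w' = frame_change i b w).
    by rewrite hE lE mE /param_change !w'E.
  by apply/matrixP=> r c; rewrite !mxE w'E.
pose S : {fset {fset {fset {vspace 'rV[k]_4}}}} := [fset D in map f s]%fset.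
exists S; split=> [D|]; last first.
  rewrite /S card_fseq; have := size_le_fibres us fibre.
  rewrite size_allpairs szU szpairs => le_s; apply: leq_trans le_s _.
  by rewrite !card_prod card_ffun card_bool card_ord card_seq_sub // szL.
rewrite /S inE => /mapP[[g [l m]] /sP[/= gA lL mL lm] ->].
have ug := unitary_frame_unit gA.
(* A ratio of elements of norm 1 has norm 1, so multiplication by it preserves N. *)
have NM a x y : x \in L -> y \in L -> a \in N -> x / y * a \in N.
  rewrite !LE !NE => /eqP xL /eqP yL /eqP aN.
  by rewrite exprMn expr_div_n xL yL aN divr1 mul1r.
split.
  by rewrite -cN; apply: frame_double_2d; rewrite ?L0 // => a; apply: NM.
move=> X XD z zX v vz;
  have /frame_double_coverP zC : exists2 X, X \in frame_double N g l m & z \in X by exists X.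
have iso h nu : h^f *m A *m h^T = 1%:M -> nu \in L -> z \in ruling N h nu -> evalv F v = 0.
  rewrite LE => hA /eqP nL /rulingP[a]; rewrite NE => /eqP aN zE; rewrite zE in vz.
  have := ruling_line_isotropic hA aN nL vz; rewrite FE => /matrixP/(_ 0 0).
  by rewrite !mxE.
have sA := unitary_swap_frame gA.
by case/or4P: zC; [apply: iso | apply: iso | apply: iso | apply: iso].
Qed.

End Configurations.

Local Open Scope fset_scope.

Theorem corollary6p3p2 (k : closedFieldType) (p e q d : nat)
    (F : {mpoly k[4]}) (hp : p \in [pchar k]) (he : (1 <= e)%N)
    (hq : q = (p ^ e)%N) (hd : d = (q + 1)%N) (hd5 : (5 <= d)%N)
    (hF : Frobenius_form q F) (hsmooth : smooth_surface F) :
  exists S : {fset {fset {fset subspace4 k}}},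
    (forall D, D \in S -> double_2d d D /\ contained_in D F) /\
    1 / 16%:R * (q%:R ^+ 3 + 1) * (q%:R ^+ 2 + 1) * (q%:R - 1) ^+ 2 * q%:R ^+ 7
      <= #|` S|%:R :> rat.
Proof.
have q_nat : [pchar k].-nat q by rewrite hq pnatX pnatE ?hp ?(pcharf_prime hp).
have q4 : (4 <= q)%N by move: hd5; rewrite hd addn1.
have q1 : (1 < q)%N by apply: leq_trans q4.
have [A [FE dF]] := Frobenius_formP q_nat q1 hF.
have uA := smooth_matrix_unit q4 hsmooth FE dF.
have [S [SP leS]] := frame_doubles_on_surface q4 uA FE.
exists S; split; first by rewrite hd addn1.
move: leS (unitary_group_card q1); move: (\prod_(1 <= i < 5) _)%N => P leS PE.
move: leS; rewrite -(ler_nat rat) [leLHS]natrM (natrM _ q.+1) PE [leRHS]natrM (natrM _ 16) natrX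
  => leS.
have Q0 : 0 < q.+1%:R ^+ 4 :> rat by rewrite exprn_gt0 ?ltr0Sn.
(* The positive factor y to be cancelled is (q + 1)^4. *)
have key (x y z : rat) : 0 < y -> x * y <= 16%:R * y * z -> 1 / 16%:R * x <= z.
  move=> y0 xyz; rewrite mul1r mulrC ler_pdivrMr // -(ler_pM2r y0).
  by rewrite (_ : z * 16%:R * y = 16%:R * y * z) //; ring.
by have := key _ _ _ Q0 leS; rewrite !mulrA.
Qed.
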